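(* Let $d\ge1$ be an integer and let $B(d)$ be the Birkhoff polytope of $d\times d$ doubly stochastic matrices. Let $H_d(k)$ denote the number of $d\times d$ magic squares with linear sums equal to $k$. Then $$\mathrm{vol}(B(d))=\frac{1}{((d-1)^2)!\;d^{(d-1)^2}}\sum_{m=0}^{n}(-1)^{n+m}\left(\binom{(d-1)^2}{n-m}+(-1)^d\binom{(d-1)^2}{n+m+1}\right)H_d(md),$$ where $n:=\lfloor (d-1)^2/2\rfloor$.
   Context: $B(d)\subset\mathbb{R}^{d^2}$ is the set of real $d\times d$ matrices $(x_{i,j})$ with $x_{i,j}\ge0$ and all row sums and all column sums equal to $1$; it has dimension $(d-1)^2$. A magic square with linear sums $k$ is a $d\times d$ matrix of non-negative integers all of whose row sums and column sums equal $k$. The volume $\mathrm{vol}(B(d))$ is the $(d-1)^2$-dimensional volume in the affine hull of $B(d)$, normalised with respect to the lattice $\mathrm{aff}(B(d))\cap\mathbb{Z}^{d^2}$, so that a fundamental parallelepiped of this lattice has volume $1$ (a single point, in dimension $0$, has volume $1$). *)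

(* Defs.v *)
From HB Require Import structures.
From mathcomp Require Import all_boot all_order all_algebra.
From mathcomp Require Import finmap.
From mathcomp Require Import all_classical all_reals all_analysis.

Set Implicit Arguments.
Unset Strict Implicit.
Unset Printing Implicit Defensive.

Import Order.TTheory GRing.Theory Num.Theory.

Local Open Scope classical_set_scope.
Local Open Scope ring_scope.

Definition birkhoff (R : realType) (d : nat) : set 'M[R]_d :=
  [set X | [/\ forall i j, 0 <= X i j,
               forall i, \sum_j X i j = 1
             & forall j, \sum_i X i j = 1]].
Arguments birkhoff : clear implicits.

Definition magic_squares (d k : nat) : set 'M[nat]_d :=
  [set A | (forall i, (\sum_j A i j)%N = k) /\ (forall j, (\sum_i A i j)%N = k)].
Arguments magic_squares : clear implicits.

(* [magic_squares d k] is finite, since the entries are at most k, so the *)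
(* default value of [fset_set] on infinite sets is never used.            *)
Definition nb_magic_squares (d k : nat) : nat :=
  #|` fset_set (magic_squares d k)|.

(* m-dimensional Lebesgue outer measure; on closed sets it is the Lebesgue   *)
(* measure. The covers are indexed by a subset D of nat, and not by all of   *)
(* nat, because of dimension 0: there every box is the whole space and has   *)
(* volume 1 (empty product), so only a finite cover of the point gives 1.    *)
Definition box (R : realType) (m : nat) (a b : 'rV[R]_m) : set 'rV[R]_m :=
  [set x | forall i, a 0 i <= x 0 i <= b 0 i].

Definition lebesgue_outer (R : realType) (m : nat) (A : set 'rV[R]_m) : \bar R :=
  ereal_inf [set s | exists (D : set nat) (a b : nat -> 'rV[R]_m),
    [/\ forall k i, a k 0 i <= b k 0 i,
        A `<=` \bigcup_(k in D) box (a k) (b k)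
      & s = \esum_(k in D) (\prod_i (b k 0 i - a k 0 i))%:E]].

Definition affine_hull (R : realType) (V : lmodType R) (P : set V) : set V :=
  [set x | exists (n : nat) (c : 'I_n -> R) (p : 'I_n -> V),
    [/\ forall i, P (p i), \sum_i c i = 1 & x = \sum_i c i *: p i]].

Definition integer_points (R : realType) (p q : nat) : set 'M[R]_(p, q) :=
  [set A | forall i j, A i j \is a Num.int].
Arguments integer_points : clear implicits.

Definition affine_chart (R : realType) (V : lmodType R) (m : nat)
    (p0 : V) (b : 'I_m -> V) (t : 'rV[R]_m) : V :=
  p0 + \sum_i t 0 i *: b i.

(* p0 and b are an origin and a basis of the affine lattice of integer points *)
(* of aff(P), where dim aff(P) = m: the chart identifies R^m with aff(P) and  *)
(* Z^m with this lattice, so that it maps the unit cube to a fundamental      *)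
(* parallelepiped.                                                            *)
Definition lattice_frame (R : realType) (p q m : nat) (P : set 'M[R]_(p, q))
    (p0 : 'M[R]_(p, q)) (b : 'I_m -> 'M[R]_(p, q)) : Prop :=
  [/\ injective (affine_chart p0 b),
      range (affine_chart p0 b) = affine_hull P
    & affine_chart p0 b @` integer_points R 1 m =
        affine_hull P `&` integer_points R p q].

(* The m-dimensional volume of P in its affine hull, normalised by the        *)
(* lattice of integer points, is v: a lattice frame exists, and the volume    *)
(* computed in any lattice frame is v.                                        *)
Definition normalized_volume (R : realType) (p q m : nat) (P : set 'M[R]_(p, q))
    (v : \bar R) : Prop :=
  (exists (p0 : 'M[R]_(p, q)) (b : 'I_m -> 'M[R]_(p, q)), lattice_frame P p0 b) /\
  (forall (p0 : 'M[R]_(p, q)) (b : 'I_m -> 'M[R]_(p, q)), lattice_frame P p0 b ->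
     lebesgue_outer (affine_chart p0 b @^-1` P) = v).

(* Main.v *)
Require Import Defs.
From HB Require Import structures.
From mathcomp Require Import all_boot all_order all_algebra.
From mathcomp Require Import fingroup perm finmap.
From mathcomp Require Import all_classical all_reals all_analysis.
From mathcomp Require Import ring lra zify.

(* Fix a generic real matrix p with equal line sums and consider the magic squares A such that A + e p is interior to *)
(* the cone of nonnegative matrices with equal line sums for all small e > 0. Choosing a permutation s in the support *)
(* of p and subtracting it from A until an entry vanishes splits this set into copies of N x (the same problem for    *)
(* p - p_e s on the facet x_e = 0), e running over the edges of s. By induction the set is a disjoint union of        *)
(* half-open unimodular simplicial cones, and replacing p by - p exchanges their closed and open facets. For p > 0    *)
(* this gives sequences counting all magic squares (p) and the positive ones (- p); adding 1 to all entries relates   *)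
(* the two. So k |-> H_d(k) is a polynomial P of degree N = (d-1)^2 with P(-d-k) = (-1)^N P(k), and the sum of the    *)
(* theorem is the N-th difference with step d of P at the points -d(N-n), ..., dn, i.e. N! d^N times the leading      *)
(* coefficient. That coefficient is the volume: in any lattice frame H_d(k) counts the points of (1/k) Z^N in the     *)
(* polytope, and comparing this count with cubes of side 1/k (resp. with a finite subcover of a given cover) bounds   *)
(* the outer measure from above (resp. from below).                                                                   *)

Set Implicit Arguments.
Unset Strict Implicit.
Unset Printing Implicit Defensive.

Import Order.TTheory GRing.Theory Num.Theory.
Import numFieldNormedType.Exports.

Local Open Scope ring_scope.

(** * Hall's theorem and permutations in the support of a matrix *)

(** The plan stated above has a combinatorial, an arithmetic and a metric half; write N = (d-1)^2.
    Combinatorics: permutation matrices have line sums 1, so they serve as generators of unimodular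
    cones. [perm_in_support] (from [hall_marriage]) supplies the next generator, [nb_half_open_rec]
    is the disjoint splitting it induces, and [half_open_count] iterates it down to dimension 0. The
    result is a list t with one entry u, the number of missing facets, for each simplicial cone.
    Genericity of p ([generic_exists]) ensures that edges of the permutation with equal values of p
    cut out the same facet, so that each step lowers the dimension by exactly one. Arithmetic: the
    cone of u contributes the polynomial [rising] divided by N!, and [rising_opp] exchanges u and N
    + 1 - u. The mirror images of the points md, 0 <= m <= n, are the points -(md + d); together
    they are equally spaced and suffice for an N-th difference ([finite_difference]), which
    [count_alternating_sum] evaluates to [size t] times d^N. Metric half: H_d(k) / k^N tends to
    [size t] / N! ([count_bounds]), and [outer_le_count] and [count_le_cover] squeeze the outer
    measure to this limit in [birkhoff_volume]. *)

Definition nbhd (T T' : finType) (r : T -> T' -> bool) (Y : {set T}) : pred T' :=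
  [pred j | [exists i, (i \in Y) && r i j]].

(* Halmos-Vaughan: either some proper subset of X is tight, and it can be matched
   separately, or any edge at a given x can be used. *)
Lemma hall_marriage (T T' : finType) (y0 : T') (r : T -> T' -> bool) (X : {set T}) :
  (forall Y : {set T}, Y \subset X -> (#|Y| <= #|nbhd r Y|)%N) ->
  exists f : T -> T', {in X &, injective f} /\ {in X, forall i, r i (f i)}.
Proof.
move: {2}#|X| (leqnn #|X|) => n; elim: n r X => [|n IHn] r X.
  rewrite leqn0 cards_eq0 => /eqP -> _; exists (fun=> y0).
  by split=> [i j|i]; rewrite inE.
move=> leX HX; have [X0|[x xX]] := finset.set_0Vmem X.
  by exists (fun=> y0); rewrite X0; split=> [i j|i]; rewrite inE.
have [/existsP [Y /and3P [YX Y0 tY]]|/existsPn noY] :=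
  boolP [exists Y : {set T}, [&& Y \proper X, (0 < #|Y|)%N & (#|nbhd r Y| <= #|Y|)%N]].
- have cY : (#|Y| <= n)%N.
    by rewrite -ltnS (leq_trans _ leX)// proper_card.
  have [|f1 [f1i f1r]] := IHn r Y cY.
    by move=> W WY; apply: HX; exact: fintype.subset_trans WY (fintype.proper_sub YX).
  pose r' i j := r i j && (j \notin nbhd r Y).
  have cXY : (#|X :\: Y| <= n)%N.
    rewrite -ltnS (leq_trans _ leX)// proper_card// fintype.properE finset.subsetDl /=.
    apply/fintype.subsetPn; case/card_gt0P: Y0 => y yY.
    by exists y; rewrite ?inE ?yY// (fintype.subsetP (fintype.proper_sub YX)).
  have [|f2 [f2i f2r]] := IHn r' _ cXY.
    move=> W WXY; have dWY : [disjoint W & Y].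
      rewrite disjoint_subset; apply/fintype.subsetP => w /(fintype.subsetP WXY).
      by rewrite !inE => /andP[].
    have := HX (W :|: Y); rewrite finset.subUset (fintype.subset_trans WXY (finset.subsetDl _ _)).
    rewrite (fintype.proper_sub YX) => /(_ isT).
    have -> : #|W :|: Y| = (#|W| + #|Y|)%N.
      by apply/eqP; rewrite (leq_card_setU W Y).
    have : (#|nbhd r (W :|: Y)| <= #|nbhd r' W| + #|nbhd r Y|)%N.
      rewrite -cardUI (leq_trans _ (leq_addr _ _))// subset_leq_card//.
      apply/fintype.subsetP => j; rewrite !inE => /existsP [i /andP[]].
      case: (boolP [exists i, (i \in Y) && r i j]) => [|nj]; rewrite ?orbT ?orbF//.
      rewrite !inE => /orP[iW|iY] rij.
        by apply/existsP; exists i; rewrite iW /r' rij inE.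
      by case/existsP: nj; exists i; rewrite iY.
    lia.
  exists (fun i => if i \in Y then f1 i else f2 i); split=> [i j iX jX|i iX].
    have key k l : k \in Y -> l \in X -> l \notin Y -> f1 k <> f2 l.
      move=> kY lX lY e; have := f2r l; rewrite inE lY lX => /(_ isT) /andP[_].
      by rewrite -e inE => /existsP; apply; exists k; rewrite kY f1r.
    case: ifPn => iY; case: ifPn => jY.
    + exact: f1i.
    + by move/(key _ _ iY jX jY).
    + by move/esym/(key _ _ jY iX iY).
    + by apply: f2i; rewrite inE ?iY ?jY.
  case: ifPn => iY; first exact: f1r.
  by have := f2r i; rewrite inE iY iX => /(_ isT) /andP[].
- have /card_gt0P [y] : (0 < #|nbhd r [set x]%SET|)%N.
    by apply: leq_trans (HX [set x]%SET _); rewrite ?cards1// finset.sub1set.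
  rewrite inE => /existsP[_ /andP[/set1P -> rxy]].
  pose r' i j := r i j && (j != y).
  have cXx : (#|X :\ x| <= n)%N.
    by rewrite -ltnS (leq_trans _ leX)// (cardsD1 x X) xX.
  have [|f [fi fr]] := IHn r' _ cXx.
    move=> W WX; have [W0|W0] := posnP #|W|; first by rewrite W0.
    have := noY W; rewrite W0 andbA andbT.
    have -> : W \proper X.
      apply: fintype.sub_proper_trans WX _; rewrite finset.properD1//.
    rewrite /= -ltnNge => lt.
    suff : (#|nbhd r W| <= #|nbhd r' W| + 1)%N by lia.
    rewrite -(card1 y) -cardUI (leq_trans _ (leq_addr _ _))// subset_leq_card//.
    apply/fintype.subsetP => j; rewrite !inE => /existsP [i /andP[iW rij]].
    case: (eqVneq j y) => [|nj]; rewrite ?orbT// orbF.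
    by apply/existsP; exists i; rewrite iW /r' rij nj.
  exists (fun i => if i == x then y else f i); split=> [i j iX jX|i iX].
    have key l : l \in X -> l != x -> y <> f l.
      move=> lX lx e; have := fr l; rewrite !inE lx lX => /(_ isT) /andP[_].
      by rewrite e eqxx.
    case: eqVneq => [->|ix]; case: eqVneq => [->|jx]//.
    + by move/(key _ jX jx).
    + by move/esym/(key _ iX ix).
    + by apply: fi; rewrite !inE ?ix ?jx.
  case: eqVneq => [->//|ix].
  by have := fr i; rewrite !inE ix iX => /(_ isT) /andP[].
Qed.

Section LineSums.
Variable d : nat.

Definition line_sums (V : nmodType) (A : 'M[V]_d) (k : V) : Prop :=
  (forall i, \sum_j A i j = k) /\ (forall j, \sum_i A i j = k).

Lemma line_sumsD (V : nmodType) (A B : 'M[V]_d) k l :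
  line_sums A k -> line_sums B l -> line_sums (A + B) (k + l).
Proof.
move=> [Ar Ac] [Br Bc]; split=> i.
  by under eq_bigr do rewrite mxE; rewrite big_split /= Ar Br.
by under eq_bigr do rewrite mxE; rewrite big_split /= Ac Bc.
Qed.

Lemma line_sumsZ (K : pzRingType) (A : 'M[K]_d) k (c : K) :
  line_sums A k -> line_sums (c *: A) (c * k).
Proof.
move=> [Ar Ac]; split=> i.
  by under eq_bigr do rewrite mxE; rewrite -mulr_sumr Ar.
by under eq_bigr do rewrite mxE; rewrite -mulr_sumr Ac.
Qed.

Lemma line_sumsB (K : pzRingType) (A B : 'M[K]_d) k l :
  line_sums A k -> line_sums B l -> line_sums (A - B) (k - l).
Proof.
by move=> hA hB; rewrite -[- B]scaleN1r -[- l]mulN1r; apply/line_sumsD/line_sumsZ.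
Qed.

Lemma line_sums_natr (K : pzRingType) (A : 'M[nat]_d) k :
  line_sums A k -> line_sums (map_mx (GRing.natmul (1 : K)) A) k%:R.
Proof.
move=> [Ar Ac]; split=> i.
  by under eq_bigr do rewrite mxE; rewrite -natr_sum; congr _%:R; exact: Ar.
by under eq_bigr do rewrite mxE; rewrite -natr_sum; congr _%:R; exact: Ac.
Qed.

Lemma line_sums_perm (K : pzSemiRingType) (s : 'S_d) : line_sums (perm_mx s : 'M[K]_d) 1.
Proof.
split=> [i|j].
  rewrite (bigD1 (s i)) //= !mxE eqxx big1 ?addr0// => j /negPf sj.
  by rewrite !mxE eq_sym sj.
rewrite (bigD1 (s^-1 j)%g) //= !mxE permKV eqxx big1 ?addr0// => i sj.
rewrite !mxE; case: eqP => // e; case/eqP: sj; by rewrite -e permK.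
Qed.

Lemma line_sums_const (K : pzSemiRingType) (c : K) :
  line_sums (const_mx c : 'M[K]_d) (d%:R * c).
Proof.
split=> i; under eq_bigr do rewrite mxE;
by rewrite sumr_const card_ord mulr_natl.
Qed.

(* Birkhoff - von Neumann: the support of X satisfies Hall's condition. *)
Lemma perm_in_support (K : realFieldType) (X : 'M[K]_d) k :
  line_sums X k -> (forall i j, 0 <= X i j) -> 0 < k ->
  exists s : 'S_d, forall i, 0 < X i (s i).
Proof.
move=> [Xr Xc] X0 k0; have [d0|] := posnP d.
  by exists 1%g => i; have := ltn_ord i; rewrite [X in (_ < X)%N]d0.
move=> d0; pose y0 := Ordinal d0.
have [|f [fi fr]] := @hall_marriage _ _ y0 (fun i j => 0 < X i j) [set: 'I_d]%SET.
  move=> Y _; set Z := nbhd _ Y.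
  have : \sum_(i in Y) \sum_j X i j <= \sum_(j in Z) \sum_i X i j.
    have -> : \sum_(i in Y) \sum_j X i j = \sum_(i in Y) \sum_(j in Z) X i j.
      apply: eq_bigr => i iY; rewrite (bigID (mem Z)) /= [X in _ + X]big1 ?addr0// => j.
      rewrite inE negb_exists => /forallP /(_ i); rewrite iY /= -leNgt => Xle.
      by apply/le_anti; rewrite X0 Xle.
    rewrite exchange_big; apply: ler_sum => j _; rewrite [leRHS](bigID (mem Y)) /=.
    by rewrite lerDl sumr_ge0.
  under eq_bigr do rewrite Xr; under [leRHS]eq_bigr do rewrite Xc.
  by rewrite !sumr_const ler_pMn2l.
have finj : injective f by move=> i j; apply: fi; rewrite inE.
by exists (perm finj) => i; rewrite permE; apply: fr; rewrite inE.
Qed.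

End LineSums.

(** * Half-open cones of magic squares *)

Section HalfOpenCones.
Variable d : nat.
Implicit Types (p : 'M[rat]_d) (A B : 'M[nat]_d) (s : 'S_d).

Lemma line_sums_le A k i j : line_sums A k -> (A i j <= k)%N.
Proof. by move=> [Ar _]; rewrite -(Ar i) (bigD1 j) //= leq_addr. Qed.

(* The matrices A such that A + e p is in the relative interior of the cone of magic squares supported by supp p,
   for all small e > 0. *)
Definition half_open p k A : Prop :=
  [/\ line_sums A k, forall i j, p i j = 0 -> A i j = 0%N
    & forall i j, p i j < 0 -> (0 < A i j)%N].

(** Bounding the entries by K makes this the cardinal of a finite type. By [line_sums_le] nothing is
    lost when k <= K, and one fixed K serves all the smaller sums met in the recursion. *)
Definition nb_half_open K p k :=
  #|[pred A : 'M['I_K.+1]_d | `[< half_open p k (map_mx val A) >]]|.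

Definition shift_perm s c B : 'M[nat]_d := \matrix_(i, j) (B i j + (s i == j) * c)%N.

Lemma shift_perm_line_sums s c B k :
  line_sums (shift_perm s c B) (k + c)%N <-> line_sums B k.
Proof.
have rowE i : (\sum_j shift_perm s c B i j = (\sum_j B i j) + c)%N.
  under eq_bigr do rewrite mxE; rewrite big_split /=; congr (_ + _)%N.
  rewrite (bigD1 (s i)) //= eqxx mul1n big1 ?addn0// => j /negPf sj.
  by rewrite eq_sym sj.
have colE j : (\sum_i shift_perm s c B i j = (\sum_i B i j) + c)%N.
  under eq_bigr do rewrite mxE; rewrite big_split /=; congr (_ + _)%N.
  rewrite (bigD1 (s^-1 j)%g) //= permKV eqxx mul1n big1 ?addn0// => i sj.
  by case: eqP => // e; case/eqP: sj; rewrite -e permK.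
split=> -[hr hc]; split=> i.
- by apply/eqP; rewrite -(eqn_add2r c); rewrite -rowE; apply/eqP/hr.
- by apply/eqP; rewrite -(eqn_add2r c); rewrite -colE; apply/eqP/hc.
- by rewrite -[RHS]/(k + c)%N -(hr i); apply: rowE.
- by rewrite -[RHS]/(k + c)%N -(hc i); apply: colE.
Qed.

(** For v = p_e with e an edge of s, this is the projection of p along s onto the facet x_e = 0. *)
Definition perm_step p s v := p - v *: perm_mx s.

Lemma perm_stepE p s v i j : perm_step p s v i j = p i j - (s i == j)%:R * v.
Proof. by rewrite !mxE mulrC. Qed.

(** The perturbed matrix A + e p loses c + e v copies of s before an entry vanishes. For small e > 0
    and v nonzero this number is positive exactly when c >= 1 or v > 0, whence the condition (v < 0)
    <= c in the lemmas below. *)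
Definition perm_piece p s (k : nat) v (c : nat) A :=
  exists2 B, half_open (perm_step p s v) (k - c)%N B & A = shift_perm s c B.

Lemma perm_pieceW p s k v c A :
  (forall i, p i (s i) != 0) -> v != 0 -> ((v < 0)%R <= c <= k)%N ->
  perm_piece p s k v c A -> half_open p k A.
Proof.
move=> ps v0 /andP[vc ck] [B [Bs B0 B1] ->]; split.
- by rewrite -(subnK ck); apply/shift_perm_line_sums.
- move=> i j pij; rewrite mxE; case: eqP => [e|_].
    by move: (ps i); rewrite e pij eqxx.
  rewrite mul0n addn0; case: (eqVneq (s i) j) => [e|ne].
    by move: (ps i); rewrite e pij eqxx.
  by apply: B0; rewrite perm_stepE (negPf ne) mul0r subr0.
- move=> i j pij; rewrite mxE addn_gt0.
  have [e|ne] := eqVneq (s i) j; last first.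
    by rewrite B1 // perm_stepE (negPf ne) mul0r subr0.
  rewrite mul1n; have [v_lt0|v_ge0] := ltrP v 0; first by rewrite v_lt0 in vc; rewrite vc orbT.
  rewrite B1 // perm_stepE e eqxx mul1r; lra.
Qed.

(** Disjointness of the pieces: c and c' are both the least entry of A on s, and a value of p below
    v on an edge with entry c would force a positive entry of B there. *)
Lemma perm_piece_uniq p s k v c v' c' A :
  (exists i, p i (s i) = v) -> (exists i, p i (s i) = v') ->
  perm_piece p s k v c A -> perm_piece p s k v' c' A -> v = v' /\ c = c'.
Proof.
move=> [i pi] [i' pi'] [B [_ B0 B1] eA] [B' [_ B0' B1'] eA'].
have Ai : A i (s i) = c.
  by rewrite eA mxE eqxx mul1n B0 // perm_stepE eqxx mul1r pi subrr.
have Ai' : A i' (s i') = c'.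
  by rewrite eA' mxE eqxx mul1n B0' // perm_stepE eqxx mul1r pi' subrr.
have cc' : c = c'.
  apply/eqP; rewrite eqn_leq -{1}Ai' -{2}Ai {1}eA eA' !mxE !eqxx !mul1n.
  by rewrite !leq_addl.
split=> //; apply/le_anti/andP; split; rewrite leNgt; apply/negP => lt.
  have := B1 i' (s i'); rewrite perm_stepE eqxx mul1r pi' subr_lt0 => /(_ lt).
  by move: Ai'; rewrite eA mxE eqxx; lia.
have := B1' i (s i); rewrite perm_stepE eqxx mul1r pi subr_lt0 => /(_ lt).
by move: Ai; rewrite eA' mxE eqxx; lia.
Qed.

(* The piece of A is found by minimizing (A_e, p_e) lexicographically over the edges e of the permutation. *)
Lemma perm_piece_exists p s k A :
  (0 < d)%N -> half_open p k A ->
  (forall i i', p i (s i) = p i' (s i') -> A i (s i) = A i' (s i')) ->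
  exists v c, [/\ exists i, p i (s i) = v, ((v < 0)%R <= c <= k)%N & perm_piece p s k v c A].
Proof.
move=> d0 [As A0 A1] par; pose y0 := Ordinal d0.
case: (@arg_minnP _ y0 xpredT (fun i => A i (s i))) => // i1 _ min1.
case: (@arg_minP _ _ _ i1 [pred i | A i (s i) == A i1 (s i1)] (fun i => p i (s i))) => [|i0 /eqP Ai0 min0].
  by rewrite /= eqxx.
set v := p i0 (s i0) in min0; set c := A i0 (s i0) in Ai0.
have cA i : (c <= A i (s i))%N by rewrite Ai0 min1.
have ck : (c <= k)%N by apply: line_sums_le.
exists v, c; split; first by exists i0.
  by rewrite ck andbT; case: ltrP => // v0; apply: A1.
have eA : A = shift_perm s c (\matrix_(i, j) (A i j - (s i == j) * c)%N).
  apply/matrixP => i j; rewrite !mxE subnK//.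
  by case: eqP => [<-|_]; rewrite ?mul1n ?mul0n.
exists (\matrix_(i, j) (A i j - (s i == j) * c)%N) => //; split.
- by apply/(shift_perm_line_sums s c); rewrite -eA subnK.
- move=> i j; rewrite perm_stepE mxE.
  have [<-|ne] := eqVneq (s i) j; last by rewrite mul0r subr0 => /A0 ->.
  (* On an edge where p also equals v, [par] gives A the entry c, so that B vanishes there as
     required. *)
  by rewrite mul1r mul1n => /eqP; rewrite subr_eq0 => /eqP /par ->; rewrite -/c subnn.
- move=> i j; rewrite perm_stepE mxE.
  have [<-|ne] := eqVneq (s i) j; last by rewrite mul0r subr0 mul0n subn0 => /A1.
  rewrite mul1r mul1n subr_lt0 subn_gt0 => pv.
  rewrite ltn_neqAle cA andbT; apply/eqP => e.
  by have := min0 i; rewrite /= -e Ai0 eqxx leNgt pv => /(_ isT).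
Qed.

Lemma card_perm_piece K p s k v c : (c <= k)%N -> (k <= K)%N ->
  #|[pred A : 'M['I_K.+1]_d | `[< perm_piece p s k v c (map_mx val A) >]]|
  = nb_half_open K (perm_step p s v) (k - c)%N.
Proof.
move=> ck kK; rewrite /nb_half_open.
pose sh (B : 'M['I_K.+1]_d) : 'M['I_K.+1]_d :=
  map_mx inord (shift_perm s c (map_mx val B)).
set P := (X in _ = #|X|).
have valsh (B : 'M['I_K.+1]_d) : B \in P -> map_mx val (sh B) = shift_perm s c (map_mx val B).
  move=> /asboolP [Bs _ _]; apply/matrixP => i j.
  rewrite !mxE /= inordK // ltnS.
  have := line_sums_le i j Bs; rewrite mxE; case: eqP => _ /=; lia.
have shi : {in P &, injective sh}.
  move=> B B' BP BP' e; apply/matrixP => i j; apply/val_inj.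
  have := valsh B BP; rewrite e valsh// => /matrixP /(_ i j); rewrite !mxE.
  by move=> /eqP; rewrite eqn_add2r => /eqP.
rewrite -(card_in_image shi); apply: eq_card => A; rewrite inE.
apply/asboolP/fintype.imageP => [[B hB eA]|[B BP ->]]; last first.
  by exists (map_mx val B); [apply/asboolP|rewrite valsh].
have eB : map_mx val (map_mx (@inord K) B) = B.
  apply/matrixP => i j; rewrite !mxE /= inordK// ltnS.
  by have [Bs _ _] := hB; have := line_sums_le i j Bs; lia.
have BP : map_mx inord B \in P by apply/asboolP; rewrite eB.
exists (map_mx inord B) => //.
by apply/matrixP => i j; apply/val_inj; have := valsh _ BP; rewrite eB -eA => /matrixP /(_ i j); rewrite !mxE.
Qed.

(** Duplicates are removed because, for generic p, edges with the same value define one and the same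
    facet, hence one piece. *)
Definition perm_values p s := undup [seq p i (s i) | i <- enum 'I_d].

Lemma mem_perm_values p s v : reflect (exists i, p i (s i) = v) (v \in perm_values p s).
Proof.
rewrite mem_undup; apply: (iffP mapP) => [[i _ ->]|[i <-]]; first by exists i.
by exists i; rewrite ?mem_enum.
Qed.

(** Double counting of the pairs of a matrix and a piece containing it: every point of the half-open
    cone lies in exactly one piece, and the pieces contain no other points. *)
Lemma nb_half_open_rec K p s k :
  (0 < d)%N -> (k <= K)%N -> (forall i, p i (s i) != 0) ->
  (forall A, half_open p k A ->
     forall i i', p i (s i) = p i' (s i') -> A i (s i) = A i' (s i')) ->
  nb_half_open K p k =
  (\sum_(v <- perm_values p s) \sum_(c < k.+1 | ((v < 0)%R <= c)%N)
     nb_half_open K (perm_step p s v) (k - c)%N)%N.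
Proof.
move=> d0 kK ps par.
transitivity (\sum_(v <- perm_values p s) \sum_(c < k.+1 | ((v < 0)%R <= c)%N)
   \sum_(A : 'M['I_K.+1]_d) (`[< perm_piece p s k v c (map_mx val A) >] : nat))%N; last first.
  apply: eq_bigr => v _; apply: eq_bigr => c _; rewrite -(card_perm_piece p s v _ kK) -1?ltnS//.
  rewrite -sum1_card [RHS]big_mkcond; apply: eq_bigr => A _.
  by rewrite unfold_in /=; case: asboolP.
under eq_bigr => v _ do rewrite exchange_big.
rewrite exchange_big /= /nb_half_open -sum1_card [LHS]big_mkcond /=.
apply: eq_bigr => A _; case: ifPn => [/asboolP hA|/asboolP nA]; last first.
  rewrite big_seq big1// => v /mem_perm_values [i pi]; rewrite big1// => c vc.
  case: asboolP => // hp; case: nA; apply: perm_pieceW hp => //.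
    by rewrite -pi.
  by rewrite vc /= -ltnS ltn_ord.
have [v [c [vi /andP[vc ck] hp]]] := perm_piece_exists d0 hA (par _ hA).
rewrite (bigD1_seq v) ?undup_uniq//=; last exact/mem_perm_values.
rewrite (bigD1 (Ordinal (ck : c < k.+1)%N)) //= asboolT//.
rewrite big1 ?addn0 => [|c' /andP[_ cc']]; last first.
  case: asboolP => // hp'; case/eqP: cc'; apply/val_inj => /=.
  by have [] := perm_piece_uniq vi vi hp' hp.
rewrite big_seq_cond big1// => v' /andP[/mem_perm_values vi' vv']; rewrite big1// => c' _.
case: asboolP => // hp'; case/eqP: vv'.
by have [] := perm_piece_uniq vi' vi hp' hp.
Qed.

End HalfOpenCones.

(** * Counting in half-open cones *)

(* The number of D-tuples of natural numbers with sum n. *)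
Fixpoint nb_tuples D n : nat :=
  if D is D'.+1 then (\sum_(j < n.+1) nb_tuples D' j)%N else (n == 0)%N.
Arguments nb_tuples (D n)%_N.

(** The number of points of height k in a cone with D generators of height 1, s of whose facets are
    missing: the s coordinates concerned are at least 1, and subtracting these ones leaves height k
    - s. *)
Definition nb_tuples_from D s k : nat := if (s <= k)%N then nb_tuples D (k - s) else 0%N.
Arguments nb_tuples_from (D s k)%_N.

Lemma nb_tuplesE D n : nb_tuples D.+1 n = 'C(n + D, D).
Proof.
elim: D n => [|D IHD] n.
  by rewrite bin0 /= big_ord_recl /= big1 ?addn0.
elim: n => [|n IHn].
  by rewrite /= big_ord1 /= -/(nb_tuples D.+1 0) IHD !add0n !binn.
rewrite -[LHS]/(\sum_(j < n.+2) nb_tuples D.+1 j)%N big_ord_recr /=.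
rewrite -[X in (X + _)%N]/(nb_tuples D.+2 n) IHn -[X in (_ + X)%N]/(nb_tuples D.+1 n.+1) IHD.
by rewrite (addSn n D.+1) binS addSnnS.
Qed.

(** Adjoining a generator whose coefficient c is at least e (0 or 1 in the application) raises the
    dimension by one and the number of missing facets by e. *)
Lemma sum_nb_tuples_from D s e k :
  (\sum_(c < k.+1 | e <= c) nb_tuples_from D s (k - c))%N = nb_tuples_from D.+1 (s + e) k.
Proof.
rewrite (reindex_inj rev_ord_inj) /=.
under eq_big => [c|c _] do [rewrite subSS|rewrite subSS subKn -1?ltnS //].
rewrite {1}/nb_tuples_from -big_mkcondr /= /nb_tuples_from.
rewrite -(big_mkord (fun c => (e <= k - c) && (s <= c))%N (fun c => nb_tuples D (c - s))).
case: leqP => ske; last first.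
  by rewrite big_nat_cond big1// => c /andP[/andP[_ ck] /andP[ec sc]]; lia.
rewrite /= -(big_mkord xpredT (fun c => nb_tuples D c)).
rewrite -[RHS]/(\sum_(0 <= c < (k - (s + e)).+1) nb_tuples D c)%N.
have -> : ((k - (s + e)).+1 = (k.+1 - e) - s)%N by lia.
transitivity (\sum_(0 + s <= c < k.+1 - e) nb_tuples D (c - s))%N; last first.
  by rewrite big_addn; apply: eq_bigr => c _; rewrite addnK.
rewrite add0n (big_nat_widenl s 0%N)// [RHS](big_nat_widen _ _ k.+1); last exact: leq_subr.
rewrite big_nat_cond [RHS]big_nat_cond; apply: eq_bigl => c.
by case: (leqP s c); case: (leqP e (k - c)); case: (ltnP c k.+1) => //=; lia.
Qed.

Section HalfOpenCount.
Variable d : nat.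
Hypothesis d_gt0 : (0 < d)%N.
Implicit Types (p x l : 'M[rat]_d) (A B : 'M[nat]_d) (s : 'S_d) (V : {vspace 'M[rat]_d}).

Definition coord_mx (i j : 'I_d) (x : 'M[rat]_d) : rat^o := x i j.

Lemma coord_mx_is_linear i j : linear (coord_mx i j).
Proof. by move=> a x y; rewrite /coord_mx !mxE. Qed.

HB.instance Definition _ i j :=
  GRing.isLinear.Build rat 'M[rat]_d rat^o _ (coord_mx i j) (coord_mx_is_linear i j).

Definition dotm l x := \sum_i \sum_j l i j * x i j.

Lemma dotmDl l l' x : dotm (l + l') x = dotm l x + dotm l' x.
Proof.
rewrite /dotm -big_split; apply: eq_bigr => i _ /=; rewrite -big_split.
by apply: eq_bigr => j _; rewrite mxE mulrDl.
Qed.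

Lemma dotmZl c l x : dotm (c *: l) x = c * dotm l x.
Proof.
rewrite /dotm mulr_sumr; apply: eq_bigr => i _; rewrite mulr_sumr.
by apply: eq_bigr => j _; rewrite mxE mulrA.
Qed.

Lemma dotmC l x : dotm l x = dotm x l.
Proof. by apply: eq_bigr => i _; apply: eq_bigr => j _; rewrite mulrC. Qed.

Lemma dotmBl l l' x : dotm (l - l') x = dotm l x - dotm l' x.
Proof. by rewrite -scaleN1r dotmDl dotmZl mulN1r. Qed.

Lemma dotm_delta i j x : dotm (delta_mx i j) x = x i j.
Proof.
rewrite /dotm (bigD1 i) //= [X in _ + X]big1 ?addr0 => [|i' i'i]; last first.
  by rewrite big1// => j' _; rewrite mxE (negPf i'i) mul0r.
rewrite (bigD1 j) //= big1 ?addr0 => [|j' j'j]; first by rewrite mxE !eqxx mul1r.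
by rewrite mxE (negPf j'j) andbF mul0r.
Qed.

Definition face_space V p :=
  forall x, x \in V <-> (exists k, line_sums x k) /\ (forall i j, p i j = 0 -> x i j = 0).

Definition generic (L : seq 'M[rat]_d) p V :=
  forall l, l \in L -> dotm l p = 0 -> forall x, x \in V -> dotm l x = 0.

(* The second part of the list is the pull-back of the list for D' under x |-> x - x_e s. *)
Fixpoint functionals D : seq 'M[rat]_d :=
  if D is D'.+1 then
    [seq delta_mx a.1 a.2 - delta_mx b.1 b.2 | a <- enum {: 'I_d * 'I_d}, b <- enum {: 'I_d * 'I_d}]
    ++ [seq la.1 - dotm la.1 (perm_mx s) *: delta_mx la.2.1 la.2.2
         | la <- [seq (l, a) | l <- functionals D', a <- enum {: 'I_d * 'I_d}], s <- enum {: 'S_d}]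
  else [::].

Lemma generic_eq D p V i j i' j' x :
  generic (functionals D.+1) p V -> x \in V -> p i j = p i' j' -> x i j = x i' j'.
Proof.
move=> gen xV e; apply/eqP; rewrite -subr_eq0 -!dotm_delta -dotmBl; apply/eqP.
apply: gen xV; last by rewrite dotmBl !dotm_delta e subrr.
by rewrite mem_cat; apply/orP; left; apply/allpairsP; exists ((i, j), (i', j')); split; rewrite ?mem_enum.
Qed.

(** At p, the functional l minus l(s) times the coordinate x_e takes the value of l at the projected
    matrix; on V', where x_e = 0, it coincides with l. *)
Lemma generic_step D p V V' s i :
  generic (functionals D.+1) p V -> (forall x, x \in V' -> x \in V /\ x i (s i) = 0) ->
  generic (functionals D) (perm_step p s (p i (s i))) V'.
Proof.
move=> gen V'V l lD; rewrite /perm_step dotmC dotmBl dotmZl ![dotm _ l]dotmC => e x /V'V[xV xi].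
have := gen (l - dotm l (perm_mx s) *: delta_mx i (s i)).
rewrite dotmBl dotmZl dotm_delta => h.
have := h _ _ x xV; rewrite dotmBl dotmZl dotm_delta xi mulr0 subr0; apply.
  rewrite mem_cat; apply/orP; right; apply/allpairsP; exists ((l, (i, s i)), s).
  split; rewrite ?mem_enum//; apply/allpairsP; exists (l, (i, s i)).
  by split; rewrite ?mem_enum.
by rewrite mulrC.
Qed.

(** V' is the kernel of the coordinate x_e on V. This coordinate is 1 on the permutation matrix s,
    which lies in V, so the dimension drops by one; by genericity the new zeros of the projected p
    are edges on which x agrees with x_e. *)
Lemma face_space_step D p V s i :
  face_space V p -> generic (functionals D.+1) p V -> \dim V = D.+1 -> (forall i, p i (s i) != 0) ->
  exists V', [/\ face_space V' (perm_step p s (p i (s i))), \dim V' = D &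
    forall x, x \in V' -> x \in V /\ x i (s i) = 0].
Proof.
move=> fV gen dV ps; set f : 'Hom('M[rat]_d, rat^o) := linfun (coord_mx i (s i)).
have fE x : f x = x i (s i) by rewrite lfunE.
have mem x : (x \in (V :&: lker f)%VS) = (x \in V) && (x i (s i) == 0).
  by rewrite memv_cap memv_ker fE.
have piV : perm_mx s \in V.
  apply/fV; split; first by exists 1; apply: line_sums_perm.
  move=> i' j' e; rewrite !mxE; case: eqP => // e'.
  by move: (ps i'); rewrite e' e eqxx.
exists (V :&: lker f)%VS; split.
- move=> x; rewrite mem; split.
    move=> /andP[xV /eqP xi]; have /fV[xl x0] := xV; split=> // i' j'.
    rewrite perm_stepE; case: eqP => [<-|_]; last by rewrite mul0r subr0 => /x0.
    rewrite mul1r => /eqP; rewrite subr_eq0 => /eqP e.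
    by rewrite (generic_eq gen xV e) xi.
  move=> [xl x0]; rewrite x0 ?eqxx ?andbT; last by rewrite perm_stepE eqxx mul1r subrr.
  apply/fV; split=> // i' j' pij; apply: x0; rewrite perm_stepE pij.
  case: eqP => [e|_]; last by rewrite mul0r subr0.
  by move: (ps i'); rewrite e pij eqxx.
- have : (\dim (V :&: lker f) + \dim (f @: V) = \dim V)%N by apply: limg_ker_dim.
  suff -> : \dim (f @: V) = 1%N by rewrite dV addn1 => -[].
  apply/eqP; rewrite eqn_leq; apply/andP; split.
    by rewrite (leq_trans (dimvS (subvf _)))// dimvf.
  rewrite lt0n dimv_eq0; apply/eqP => f0.
  have := memv_img f piV; rewrite f0 memv0 fE !mxE eqxx; by rewrite oner_eq0.
- by move=> x; rewrite mem => /andP[-> /eqP].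
Qed.

(* For M large, M A + p is nonnegative and has the same support as p. *)
Lemma half_open_support p k A :
  (exists c, line_sums p c) -> p != 0 -> half_open p k A ->
  exists s, forall i, p i (s i) != 0.
Proof.
move=> [c pc] p0 [As A0 A1].
pose M : rat := 1 + \sum_i \sum_j `|p i j|.
have Mp i j : `|p i j| < M.
  rewrite /M (bigD1 i) //= (bigD1 j) //=.
  have : 0 <= \sum_(j' < d | j' != j) `|p i j'| by apply: sumr_ge0.
  have : 0 <= \sum_(i' < d | i' != i) \sum_j `|p i' j| by apply: sumr_ge0 => ? _; apply: sumr_ge0.
  lra.
pose X := M *: map_mx (GRing.natmul (1 : rat)) A + p.
have XE i j : X i j = M * (A i j)%:R + p i j by rewrite !mxE.
have X0 i j : p i j = 0 -> X i j = 0 by move=> e; rewrite XE A0// mulr0 e addr0.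
have X1 i j : p i j != 0 -> 0 < X i j.
  move=> pij; rewrite XE; have [p_lt0|p_ge0] := ltrP (p i j) 0.
    have A_ge1 : 1 <= (A i j)%:R :> rat by rewrite ler1n A1.
    have := Mp i j; rewrite ltr0_norm// => Mpij.
    have M0 : 0 < M by apply: le_lt_trans (Mp i j).
    have : M * 1 <= M * (A i j)%:R by rewrite ler_pM2l.
    lra.
  have : 0 < p i j by rewrite lt_neqAle eq_sym pij.
  have M0 : 0 < M by apply: le_lt_trans (Mp i j).
  have : 0 <= M * (A i j)%:R by rewrite mulr_ge0// ltW.
  lra.
have X_ge0 i j : 0 <= X i j.
  by have [/X0 ->//|/X1/ltW] := eqVneq (p i j) 0.
have Xs : line_sums X (M * k%:R + c).
  by apply: line_sumsD => //; apply: line_sumsZ; apply: line_sums_natr.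
have [|s hs] := perm_in_support Xs X_ge0; last first.
- by exists s => i; apply/eqP => /X0 e; have := hs i; rewrite e ltxx.
have [[i j] pij] : exists e : 'I_d * 'I_d, p e.1 e.2 != 0.
  apply/existsP; apply: contraNT p0; rewrite negb_exists => /forallP h.
  by apply/eqP/matrixP => i j; have := h (i, j); rewrite negbK mxE => /eqP.
rewrite -(proj1 Xs i) (bigD1 j) //=; apply: ltr_wpDr; last exact: X1.
exact: sumr_ge0.
Qed.

Lemma half_open_in_face V p k A : face_space V p -> half_open p k A ->
  map_mx (GRing.natmul (1 : rat)) A \in V.
Proof.
move=> fV [As A0 _]; apply/fV; split; first by exists k%:R; apply: line_sums_natr.
by move=> i j pij; rewrite mxE A0.
Qed.

Lemma nb_half_open0 K k : (k <= K)%N -> nb_half_open K (0 : 'M[rat]_d) k = (k == 0)%N.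
Proof.
move=> kK; rewrite /nb_half_open; case: eqP => [->|k0]; last first.
  apply: eq_card0 => A; apply/asboolP => -[As A0 _]; apply: k0.
  rewrite -(proj1 As (Ordinal d_gt0)) big1// => j _; apply: A0; by rewrite mxE.
transitivity #|pred1 (const_mx ord0 : 'M['I_K.+1]_d)|; last by rewrite card1.
apply: eq_card => A.
rewrite !inE; apply/asboolP/eqP => [[_ A0 _]|->].
  apply/matrixP => i j; apply/val_inj; rewrite mxE.
  by have := A0 i j; rewrite !mxE => ->.
split=> [|i j _|i j]; rewrite ?mxE ?ltxx//.
by split=> i; rewrite big1// => j _; rewrite !mxE.
Qed.

Lemma half_openN0 K p k : (forall A, ~ half_open p k A) -> nb_half_open K p k = 0%N.
Proof. by move=> h; apply: eq_card0 => A; apply/asboolP/h. Qed.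

Lemma nb_half_open_rec_face D V p s K k :
  (k <= K)%N -> (forall i, p i (s i) != 0) -> face_space V p -> generic (functionals D.+1) p V ->
  nb_half_open K p k =
  (\sum_(v <- perm_values p s) \sum_(c < k.+1 | ((v < 0)%R <= c)%N)
     nb_half_open K (perm_step p s v) (k - c)%N)%N.
Proof.
move=> kK ps fV gen; apply: (nb_half_open_rec d_gt0 kK ps) => A hA i i' e.
have := generic_eq gen (half_open_in_face fV hA) e; rewrite !mxE => /eqP.
by rewrite eqr_nat => /eqP.
Qed.

Lemma perm_valuesN p s : perm_values (- p) s = [seq - v | v <- perm_values p s].
Proof.
rewrite /perm_values -undup_map_inj; last exact: oppr_inj.
by rewrite -[in RHS]map_comp; congr undup; apply/eq_in_map => i _ /=; rewrite mxE.
Qed.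

Lemma perm_stepN p s v : perm_step (- p) s (- v) = - perm_step p s v.
Proof. by rewrite /perm_step scaleNr opprK opprB addrC. Qed.

Lemma face_spaceN V p : face_space V p -> face_space V (- p).
Proof.
move=> fV x; split=> [/fV[xl x0]|[xl x0]]; [split=> // i j|apply/fV; split=> // i j].
  by rewrite mxE => /eqP; rewrite oppr_eq0 => /eqP /x0.
by move=> pij; apply: x0; rewrite mxE pij oppr0.
Qed.

Lemma genericN L V p : generic L p V -> generic L (- p) V.
Proof.
move=> gen l lL; rewrite dotmC -scaleN1r dotmZl mulN1r => /eqP.
by rewrite oppr_eq0 dotmC => /eqP /(gen l lL).
Qed.

(* The list t records the half-open simplices of the decomposition by their number of missing facets; *)
(* passing from p to - p exchanges missing and present facets. *)
Theorem half_open_count (D : nat) p V :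
  (exists c, line_sums p c) -> face_space V p -> \dim V = D -> generic (functionals D) p V ->
  exists t : seq nat, all (fun u => u <= D)%N t /\
    forall K k, (k <= K)%N ->
      nb_half_open K p k = (\sum_(u <- t) nb_tuples_from D u k)%N /\
      nb_half_open K (- p) k = (\sum_(u <- t) nb_tuples_from D (D - u) k)%N.
Proof.
elim: D p V => [|D IHD] p V pc fV dV gen.
(* If neither p nor - p has any point, the list is empty. Otherwise, when p is nonzero, such a point
   yields a permutation in their common support. *)
all: have [[k [A hA]]|nA] := pselect (exists k A, half_open p k A \/ half_open (- p) k A); last first.
all: try by exists [::]; split=> // K k kK; rewrite !big_nil !half_openN0// => A hA;
  apply: nA; exists k, A; [right|left].
all: have nz : p != 0 -> exists s, forall i, p i (s i) != 0.
all: try (move=> p0; case: hA => hA; first exact: half_open_support hA;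
  case: (half_open_support _ _ hA); rewrite ?oppr_eq0//;
    [by case: pc => c pc; exists (- 1 * c); rewrite -scaleN1r; apply: line_sumsZ|
     by move=> s hs; exists s => i; have := hs i; rewrite mxE oppr_eq0]).
all: have piV s : (forall i, p i (s i) != 0) -> perm_mx s \in V.
all: try (move=> ps; apply/fV; split; [by exists 1; apply: line_sums_perm|];
  move=> i j e; rewrite !mxE; case: eqP => // e'; by move: (ps i); rewrite e' e eqxx).
(* In dimension 0 the space V contains no permutation matrix, so p vanishes and the only point is
   the zero matrix. *)
- have p0 : p = 0.
    apply/eqP; apply: contraT => /nz[s /piV].
    move/eqP: dV; rewrite dimv_eq0 => /eqP ->; rewrite memv0 => /eqP/matrixP.
    move/(_ (Ordinal d_gt0) (s (Ordinal d_gt0))); rewrite !mxE eqxx => /eqP.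
    by rewrite oner_eq0.
  exists [:: 0%N]; split=> // K k' kK; rewrite p0 oppr0 !nb_half_open0// !big_seq1.
  by rewrite /nb_tuples_from /= subn0.
have p0 : p != 0.
  apply/eqP => p0; suff V0 : V = 0%VS by rewrite V0 dimv0 in dV.
  apply/eqP; rewrite -subv0; apply/subvP => x /fV[_ x0]; rewrite memv0; apply/eqP/matrixP => i j.
  by rewrite mxE x0// p0 mxE.
have {p0 nz}[s ps] := nz p0.
have /choice[t ht] : forall v, exists t : seq nat, v \in perm_values p s ->
    all (fun u => u <= D)%N t /\ forall K k, (k <= K)%N ->
      nb_half_open K (perm_step p s v) k = (\sum_(u <- t) nb_tuples_from D u k)%N /\
      nb_half_open K (- perm_step p s v) k = (\sum_(u <- t) nb_tuples_from D (D - u) k)%N.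
  move=> v; have [/mem_perm_values[i <-]|] := boolP (v \in perm_values p s); last by exists [::].
  have [V' [fV' dV' V'V]] := face_space_step i fV gen dV ps.
  have [|t ht] := IHD _ V' _ fV' dV' (generic_step gen V'V); last by exists t.
  case: pc => c pc; exists (c - p i (s i) * 1).
  by apply: line_sumsB => //; apply/line_sumsZ/line_sums_perm.
(* The new generator s brings one more missing facet exactly when its coefficient must be at least
   1, that is, when v < 0. *)
exists (flatten [seq [seq (u + (v < 0)%R)%N | u <- t v] | v <- perm_values p s]); split.
  apply/allP => _ /flattenP[_ /mapP[v /ht[/allP tD _] ->] /mapP[u /tD uD ->]].
  by case: (v < 0); lia.
move=> K k' kK; split.
  rewrite (nb_half_open_rec_face kK ps fV gen) big_flatten big_map big_seq [RHS]big_seq.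
  apply: eq_bigr => v /ht[_ hv]; rewrite big_map.
  under [LHS]eq_bigr => c _ do rewrite (proj1 (hv _ _ (leq_trans (leq_subr c k') kK))).
  by rewrite exchange_big; apply: eq_bigr => u _; rewrite sum_nb_tuples_from.
have psN i : (- p) i (s i) != 0 by rewrite mxE oppr_eq0.
rewrite (nb_half_open_rec_face kK psN (face_spaceN fV) (genericN gen)) perm_valuesN big_map.
rewrite big_flatten big_map big_seq [RHS]big_seq.
apply: eq_bigr => v vp; have [/allP tD hv] := ht v vp; rewrite big_map perm_stepN.
under [LHS]eq_bigr => c _ do rewrite (proj2 (hv _ _ (leq_trans (leq_subr c k') kK))).
rewrite exchange_big big_seq [RHS]big_seq; apply: eq_bigr => u /tD uD; rewrite sum_nb_tuples_from.
(* As v is nonzero, exactly one of v and - v is negative, so the missing facets for p and for - p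
   add up to D + 1. *)
congr nb_tuples_from; rewrite oppr_lt0.
have /mem_perm_values[i pi] := vp; have := ps i; rewrite pi.
case: (ltgtP v 0) => //=; lia.
Qed.

End HalfOpenCount.

(** * Existence of a generic matrix *)

Section ZeroLineSums.
Variables (K : fieldType) (n : nat).

(** The columns e_(i+1) - e_0 form a basis of the vectors of sum 0, and [zls_proj] forgets the
    coordinate 0. With E for this matrix, X |-> E X E^T identifies the n x n matrices with the
    matrices of zero line sums. Both E and [zls_proj] are integral, so the identification also
    respects integer points, which [std_frame] relies on. *)
Definition zls_emb : 'M[K]_(1 + n, n) := col_mx (const_mx (-1)) 1%:M.
Definition zls_proj : 'M[K]_(n, 1 + n) := row_mx 0 1%:M.

Lemma zls_projK : zls_proj *m zls_emb = 1%:M.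
Proof. by rewrite mul_row_col mul0mx add0r mulmx1. Qed.

Lemma zls_embK m (Y : 'M[K]_(1 + n, m)) :
  (forall j, \sum_i Y i j = 0) -> zls_emb *m (zls_proj *m Y) = Y.
Proof.
move=> Y0; rewrite -{1}(vsubmxK Y) mul_row_col mul0mx add0r mul1mx mul_col_mx mul1mx.
rewrite -[RHS]vsubmxK; congr col_mx; apply/matrixP => i j; rewrite !mxE ord1.
have := Y0 j; rewrite big_split_ord big_ord1 /= => /eqP.
rewrite addrC addr_eq0 => /eqP e.
under eq_bigr do rewrite !mxE mulN1r; rewrite sumrN e opprK.
by congr (Y _ _); apply/val_inj.
Qed.

Lemma zls_emb_sums (X : 'M[K]_n) : line_sums (zls_emb *m X *m zls_emb^T) 0.
Proof.
have col m (Z : 'M[K]_(n, m)) j : \sum_i (zls_emb *m Z) i j = 0.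
  rewrite big_split_ord big_ord1 /= mul_col_mx mul1mx col_mxEu mxE.
  under [X in X + _]eq_bigr do rewrite mxE mulN1r; under [X in _ + X]eq_bigr do rewrite col_mxEd.
  by rewrite sumrN addNr.
split=> i; last by rewrite -mulmxA; apply: col.
transitivity (\sum_j (zls_emb *m X *m zls_emb^T)^T j i).
  by apply: eq_bigr => j _; rewrite [RHS]mxE.
by rewrite trmx_mul trmxK; apply: col.
Qed.

Lemma zls_surj (Y : 'M[K]_(1 + n)) :
  line_sums Y 0 -> zls_emb *m (zls_proj *m Y *m zls_proj^T) *m zls_emb^T = Y.
Proof.
move=> [Yr Yc]; rewrite !mulmxA -(mulmxA zls_emb) zls_embK//.
apply: (can_inj (@trmxK _ _ _)); rewrite !trmx_mul !trmxK zls_embK// => j.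
by under eq_bigr do rewrite mxE.
Qed.

Lemma zls_inj (X : 'M[K]_n) :
  zls_proj *m (zls_emb *m X *m zls_emb^T) *m zls_proj^T = X.
Proof.
by rewrite !mulmxA zls_projK mul1mx -mulmxA -trmx_mul zls_projK trmx1 mulmx1.
Qed.

End ZeroLineSums.

Lemma line_sums_1 (K : pzSemiRingType) n : line_sums (1%:M : 'M[K]_n) 1.
Proof. by rewrite -perm_mx1; apply: line_sums_perm. Qed.

Lemma line_sums_space n : exists V : {vspace 'M[rat]_(1 + n)},
  \dim V = (n * n).+1 /\ forall x, x \in V <-> exists k, line_sums x k.
Proof.
pose f := linfun (mulmxr (zls_emb rat n)^T \o mulmx (zls_emb rat n) : 'M[rat]_n -> 'M[rat]_(1 + n)).
have fE X : f X = zls_emb rat n *m X *m (zls_emb rat n)^T by rewrite lfunE.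
have memf x : (x \in limg f) <-> line_sums x 0.
  split=> [/memv_imgP[X _ ->]|x0]; first by rewrite fE; apply: zls_emb_sums.
  by rewrite -(zls_surj x0) -fE memv_img ?memvf.
exists (limg f + <[1%:M]>)%VS; split.
  rewrite dimv_disjoint_sum; last first.
    apply/eqP; rewrite -subv0; apply/subvP => x.
    rewrite memv_cap memv0 => /andP[/memf x0 /vlineP[c xc]].
    have := line_sumsZ c (line_sums_1 rat (1 + n)); rewrite -xc => -[xr _].
    by have := xr 0; rewrite (proj1 x0) xc mulr1 => <-; rewrite scale0r.
  rewrite dim_vline limg_dim_eq.
    have -> : (1%:M : 'M[rat]_(1 + n)) != 0.
      by apply/eqP => /matrixP/(_ 0 0)/eqP; rewrite !mxE eqxx oner_eq0.
    by rewrite dimvf dim_matrix addn1.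
  apply/eqP; rewrite -subv0; apply/subvP => X; rewrite memv_cap memv_ker fE memv0.
  move=> /andP[_ /eqP X0]; by rewrite -(zls_inj X) X0 mulmx0 mul0mx.
move=> x; split=> [/memv_addP[y /memf y0 [_ /vlineP[c ->] ->]]|[k xk]].
  by exists (0 + c * 1); apply: line_sumsD => //; apply/line_sumsZ/line_sums_1.
rewrite -(subrK (k *: 1%:M) x); apply: memv_add; last by apply/vlineP; exists k.
by apply/memf; have := line_sumsB xk (line_sumsZ k (line_sums_1 rat (1 + n))); rewrite mulr1 subrr.
Qed.

Lemma small_enough (K : realFieldType) (s : seq (K * K)) :
  exists2 e : K, 0 < e & forall a b, (a, b) \in s -> a != 0 -> `|e * b| < `|a|.
Proof.
elim: s => [|[a b] s [e e0 he]]; first by exists 1.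
have [a0|a0] := eqVneq a 0.
  by exists e => // a' b'; rewrite inE => /predU1P[[-> _]|/he//]; rewrite a0 eqxx.
exists (Num.min e (`|a| / (`|b| + 1))).
  by rewrite lt_min e0 divr_gt0// ?normr_gt0//; have := normr_ge0 b; lra.
move=> a' b'; rewrite normrM ger0_norm; last first.
  by rewrite le_min ltW//= divr_ge0// addr_ge0.
rewrite inE => /predU1P[[-> ->] _|/he h /h].
  have b1 : 0 < `|b| + 1 by have := normr_ge0 b; lra.
  apply: (@le_lt_trans _ _ (`|a| / (`|b| + 1) * `|b|)).
    by rewrite ler_wpM2r// ge_min lexx orbT.
  by rewrite mulrAC ltr_pdivrMr// ltr_pM2l ?normr_gt0// ltrDl.
rewrite normrM gtr0_norm//; apply: le_lt_trans.
by rewrite ler_wpM2r// ge_min lexx.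
Qed.

(** Functionals are treated one at a time: if l vanishes at p but not at some x in V, then p is
    moved to p + e x, with e so small that the entries stay positive and no earlier functional that
    was nonzero at p becomes zero. *)
Lemma generic_exists d (L : seq 'M[rat]_d) (V : {vspace 'M[rat]_d}) :
  (forall x, x \in V -> exists k, line_sums x k) ->
  exists p : 'M[rat]_d, [/\ exists c, line_sums p c, forall i j, 0 < p i j & generic L p V].
Proof.
move=> hV; elim: L => [|l L [p [[c pc] p0 gen]]].
  exists (const_mx 1); split=> // [|i j]; last by rewrite mxE.
  by exists (d%:R * 1); apply: line_sums_const.
have [lV|] := pselect (forall x, x \in V -> dotm l x = 0).
  exists p; split=> //; first by exists c.
  by move=> l'; rewrite inE => /predU1P[-> _|/gen].
move=> /existsNP[x /not_implyP[xV /eqP lx]].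
have [lp|/eqP lp] := pselect (dotm l p = 0); last first.
  exists p; split=> //; first by exists c.
  by move=> l'; rewrite inE => /predU1P[->|/gen//] /eqP e; rewrite e in lp.
have [e e0 he] := small_enough ([seq (dotm l' p, dotm l' x) | l' <- L] ++
  [seq (p a.1 a.2, x a.1 a.2) | a <- enum {: 'I_d * 'I_d}]).
have dE l' : dotm l' (p + e *: x) = dotm l' p + e * dotm l' x.
  by rewrite dotmC dotmDl dotmZl -!(dotmC l').
exists (p + e *: x); split.
- have [k xk] := hV x xV; exists (c + e * k).
  by apply: line_sumsD => //; apply: line_sumsZ.
- move=> i j; have := he (p i j) (x i j); rewrite mem_cat.
  have -> : (p i j, x i j) \in [seq (p a.1 a.2, x a.1 a.2) | a <- enum {: 'I_d * 'I_d}].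
    by apply/mapP; exists (i, j); rewrite ?mem_enum.
  rewrite orbT => /(_ isT); rewrite gt_eqF// => /(_ isT).
  rewrite (gtr0_norm (p0 i j)) ltr_norml !mxE => /andP[]; lra.
- move=> l'; rewrite inE => /predU1P[->|l'L]; rewrite dE.
    rewrite lp add0r => /eqP; rewrite mulf_eq0 (negPf lx) orbF => /eqP e1.
    by rewrite e1 ltxx in e0.
  move=> l'0; apply: gen => //; apply/eqP; apply: contraT => l'p.
  have := he (dotm l' p) (dotm l' x); rewrite mem_cat.
  have -> : (dotm l' p, dotm l' x) \in [seq (dotm l' p, dotm l' x) | l' <- L].
    by apply/mapP; exists l'.
  move=> /(_ isT l'p); move/eqP: l'0; rewrite addr_eq0 => /eqP ->.
  by rewrite normrN ltxx.
Qed.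

(** * From half-open cones to magic squares *)

Section MagicCount.
Variable d : nat.

Lemma nb_half_openE K (p : 'M[rat]_d) k : (k <= K)%N ->
  finite_set [set A | half_open p k A]%classic /\
  nb_half_open K p k = #|` fset_set [set A | half_open p k A]%classic|.
Proof.
move=> kK; set S := [set A | _]%classic.
set P := [pred A : 'M['I_K.+1]_d | `[< half_open p k (map_mx val A) >]].
pose f := map_mx val : 'M['I_K.+1]_d -> 'M[nat]_d.
have SE A : S A <-> A \in [seq f B | B <- enum P].
  split=> [hA|/mapP[B]]; last by rewrite mem_enum => /asboolP hB ->.
  have eA : f (map_mx (@inord K) A) = A.
    apply/matrixP => i j; rewrite !mxE /= inordK// ltnS.
    by have [As _ _] := hA; have := line_sums_le i j As; lia.
  apply/mapP; exists (map_mx (@inord K) A); rewrite ?eA// mem_enum.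
  by apply/asboolP; rewrite -/(f _) eA.
have finS : finite_set S.
  apply: (sub_finite_set (B := [set` [seq f B | B <- enum P]])%classic); last exact: finite_seq.
  by move=> A /SE.
split=> //; rewrite /nb_half_open -/P cardE -(size_map f).
apply: perm_size; apply: uniq_perm; last first.
- move=> A; rewrite in_fset_set//.
  by apply/idP/idP => [/SE hA|/set_mem/SE//]; apply/mem_set.
- exact: fset_uniq.
rewrite map_inj_uniq ?enum_uniq// => A B /matrixP e.
by apply/matrixP => i j; apply/val_inj; have := e i j; rewrite !mxE.
Qed.

End MagicCount.

(* The second sum counts the positive magic squares with sums k + d. *)
Definition ehrhart_seq d (t : seq nat) :=
  forall k, nb_magic_squares d k = (\sum_(u <- t) nb_tuples_from ((d - 1) ^ 2).+1 u k)%N /\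
    nb_magic_squares d k = (\sum_(u <- t) nb_tuples_from ((d - 1) ^ 2).+1 (((d - 1) ^ 2).+1 - u) (k + d))%N.

Lemma ehrhart_seq_exists d : (0 < d)%N ->
  exists2 t, all (fun u => u <= (d - 1) ^ 2)%N t & ehrhart_seq d t.
Proof.
case: d => // n _; rewrite /ehrhart_seq; have -> : ((n.+1 - 1) ^ 2 = n * n)%N by rewrite subn1 -mulnn.
have [V [dV memV]] := line_sums_space n.
have [p [pc p0 gen]] := generic_exists (functionals (1 + n) (n * n).+1) (fun x xV => proj1 (memV x) xV).
have fV : face_space V p.
  move=> x; split=> [/memV xk|[xk _]]; last exact/memV.
  by split=> // i j e; have := p0 i j; rewrite e ltxx.
have [t [tD ht]] := half_open_count (ltn0Sn n) pc fV dV gen.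
have ls k A : half_open p k A <-> line_sums A k.
  split=> [[]//|Ak]; split=> // i j; have := p0 i j; first by move=> + e; rewrite e ltxx.
  by move=> /lt_trans h /h; rewrite ltxx.
have lsN k A : half_open (- p) k A <-> line_sums A k /\ forall i j, (0 < A i j)%N.
  split=> [[Ak _ A1]|[Ak A1]]; split=> // i j; first by apply: A1; rewrite mxE oppr_lt0.
  by rewrite mxE => /eqP; rewrite oppr_eq0 => /eqP e; have := p0 i j; rewrite e ltxx.
have mE k : [set A | half_open p k A]%classic = magic_squares n.+1 k.
  by apply/seteqP; split=> A /ls.
have mfin k : finite_set (magic_squares n.+1 k).
  by rewrite -mE; have [] := nb_half_openE p (leqnn k).
pose g (A : 'M[nat]_(1 + n)) : 'M[nat]_(1 + n) := \matrix_(i, j) (A i j).+1.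
have gi : injective g.
  by move=> A B /matrixP e; apply/matrixP => i j; have := e i j; rewrite !mxE => -[].
have gls A k : line_sums (g A) (k + n.+1)%N <-> line_sums A k.
  have row (F : 'I_(1 + n) -> nat) : (\sum_i (F i).+1 = \sum_i F i + n.+1)%N.
    under eq_bigr do rewrite -addn1.
    by rewrite big_split sum1_card card_ord.
  split=> -[Ar Ac]; split=> i.
  - apply/eqP; rewrite -(eqn_add2r n.+1) -row -(Ar i); apply/eqP; apply: eq_bigr => j _; by rewrite mxE.
  - apply/eqP; rewrite -(eqn_add2r n.+1) -row -(Ac i); apply/eqP; apply: eq_bigr => j _; by rewrite mxE.
  - rewrite -(Ar i); under eq_bigr do rewrite mxE; exact: row.
  - rewrite -(Ac i); under eq_bigr do rewrite mxE; exact: row.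
have mNE k : [set A | half_open (- p) (k + n.+1)%N A]%classic = (g @` magic_squares n.+1 k)%classic.
  apply/seteqP; split=> [A /lsN[Ak A1]|_ [A Ak <-]]; last first.
    by apply/lsN; split=> [|i j]; [exact/gls|rewrite mxE].
  have eA : g (map_mx predn A) = A by apply/matrixP => i j; rewrite !mxE prednK.
  by exists (map_mx predn A) => //; apply/gls; rewrite eA.
have main k : nb_magic_squares n.+1 k = (\sum_(u <- t) nb_tuples_from (n * n).+1 u k)%N.
  by rewrite -(proj1 (ht _ _ (leqnn k))) (proj2 (nb_half_openE _ (leqnn k))) mE.
have mainN k : nb_magic_squares n.+1 k =
    (\sum_(u <- t) nb_tuples_from (n * n).+1 ((n * n).+1 - u) (k + n.+1))%N.
  rewrite -(proj2 (ht _ _ (leqnn _))) (proj2 (nb_half_openE _ (leqnn _))) mNE.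
  rewrite fset_set_image// card_imfset//.
exists t => //; apply/allP => u ut; have := allP tD u ut; rewrite leq_eqVlt => /predU1P[e|]; last by rewrite ltnS.
(* A cone with all its facets missing for p would be closed for - p and contribute a point of height
   0, but no positive square has line sums 0. *)
have := proj2 (ht 0%N 0%N isT); rewrite (big_rem u) //= e subnn.
have -> : nb_half_open 0 (- p) 0 = 0%N.
  apply: half_openN0 => A /lsN[[Ar _] /(_ ord0 ord0)].
  by have := Ar ord0; rewrite (bigD1 ord0) //=; lia.
rewrite {1}/nb_tuples_from leqnn subn0 -e.
by case: u {ut e} => // u; rewrite nb_tuplesE add0n binn; lia.
Qed.

(** * The Ehrhart polynomial *)

Section EhrhartPolynomial.
Variable R : realFieldType.

(** This is N! times the binomial coefficient of x - u + N over N, the counting polynomial of a cone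
    with N + 1 generators and u missing facets. *)
Definition rising N u : {poly R} := \prod_(i < N) ('X + (i.+1%:R - u%:R)%:P).

Lemma horner_rising N u x : (rising N u).[x] = \prod_(i < N) (x - u%:R + i.+1%:R).
Proof.
rewrite /rising horner_prod; apply: eq_bigr => i _.
by rewrite hornerD hornerX hornerC addrA addrAC.
Qed.

Lemma rising_monic N u : rising N u \is monic.
Proof.
apply: monic_prod => i _; rewrite -[X in 'X + X]opprK -polyCN.
exact: monicXsubC.
Qed.

Lemma size_rising N u : size (rising N u) = N.+1.
Proof.
rewrite /rising; under eq_bigr do rewrite -[_ - _]opprB polyCN.
by rewrite -big_enum size_prod_XsubC -cardE card_ord.
Qed.

Lemma rising_nat N u k : (u <= N + k)%N ->
  (rising N u).[k%:R] = N`!%:R * (nb_tuples_from N.+1 u k)%:R.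
Proof.
move=> uNk; rewrite horner_rising /nb_tuples_from; case: leqP => [uk|ku].
  rewrite nb_tuplesE -natrM mulnC bin_ffact ffact_prod natr_prod.
  rewrite (reindex_inj rev_ord_inj) /=; apply: eq_bigr => i _.
  rewrite -natrB// -natrD; congr _%:R; have := ltn_ord i; lia.
(* For k < u <= N + k the count is 0, and so is the factor of index u - k - 1. *)
have h : (u - k - 1 < N)%N by lia.
rewrite (bigD1 (Ordinal h)) //= mulr0.
have -> : k%:R - u%:R + (u - k - 1).+1%:R = 0 :> R.
  have -> : (u - k - 1).+1 = (u - k)%N by lia.
  rewrite natrB 1?ltnW//; ring.
by rewrite mul0r.
Qed.

(** Ehrhart reciprocity for one half-open simplex: changing the sign of each factor and reversing
    their order replaces u by N + 1 - u. *)
Lemma rising_opp N u x : (u <= N.+1)%N ->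
  (rising N u).[- x] = (-1) ^+ N * (rising N (N.+1 - u)).[x].
Proof.
move=> uN; rewrite !horner_rising -[N in (-1) ^+ N]card_ord -prodr_const -big_split /=.
rewrite (reindex_inj rev_ord_inj) /=; apply: eq_bigr => i _.
rewrite subnSK// natrB 1?ltnW// natrB// -[N.+1]addn1 -[i.+1]addn1 !natrD; ring.
Qed.

Lemma alternating_binS N (f : nat -> R) :
  \sum_(j < N.+2) (-1) ^+ j * 'C(N.+1, j)%:R * f j =
  \sum_(j < N.+1) (-1) ^+ j * 'C(N, j)%:R * (f j - f j.+1).
Proof.
rewrite big_ord_recl /= expr0 bin0.
under eq_bigr => j _ do rewrite /bump add1n binS natrD exprS.
rewrite (eq_bigr (fun j : 'I_N.+1 => (-1) ^+ j.+1 * 'C(N, j.+1)%:R * f j.+1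
   - (-1) ^+ j * 'C(N, j)%:R * f j.+1)); last by move=> j _; rewrite exprS; ring.
rewrite sumrB addrA.
have -> : 1 * 1%:R * f 0%N + \sum_(j < N.+1) (-1) ^+ j.+1 * 'C(N, j.+1)%:R * f j.+1 =
   \sum_(j < N.+1) (-1) ^+ j * 'C(N, j)%:R * f j.
  rewrite big_ord_recr /= bin_small// mulr0 mul0r addr0.
  by rewrite [RHS]big_ord_recl /= expr0 bin0.
by rewrite -sumrB; apply: eq_bigr => j _; rewrite mulrBr.
Qed.

Lemma size_XsubX_subC (c : R) i : (size ('X^(i.+1) - ('X - c%:P) ^+ i.+1)%R <= i.+1)%N /\
  ('X^(i.+1) - ('X - c%:P) ^+ i.+1)`_i = i.+1%:R * c.
Proof.
rewrite subrXX opprB addrC subrK; split.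
  rewrite mul_polyC (leq_trans (size_scale_leq _ _))//.
  apply: (leq_trans (size_sum _ _ _)); apply/bigmax_leqP => j _.
  rewrite (leq_trans (size_polyMleq _ _))// size_polyXn size_exp_XsubC.
  by have := ltn_ord j; lia.
rewrite mul_polyC coefZ coef_sum mulrC; congr (_ * _).
rewrite (eq_bigr (fun=> 1)) ?sumr_const ?card_ord// => j _.
have : 'X^(i.+1.-1 - j) * ('X - c%:P) ^+ j \is monic by rewrite rpredM ?rpredX ?monicX ?monicXsubC.
rewrite monicE lead_coefE size_monicM ?monicXn -?size_poly_eq0 ?size_exp_XsubC//.
rewrite size_polyXn => /eqP; have := ltn_ord j; rewrite ltnS => ji.
by have -> : ((i.+1.-1 - j).+1 + j.+1).-1.-1 = i by lia.
Qed.

(** Induction on N: passing from P to P - P(X - c) lowers the degree bound from N + 1 to N and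
    multiplies the top coefficient by (N + 1) c. *)
Lemma finite_difference N (P : {poly R}) a c : (size P <= N.+1)%N ->
  \sum_(j < N.+1) (-1) ^+ j * 'C(N, j)%:R * P.[a - j%:R * c] = N`!%:R * c ^+ N * P`_N.
Proof.
elim: N P => [|N IHN] P sP.
  rewrite big_ord1 bin0 fact0 (size1_polyC sP) hornerC coefC /=; ring.
rewrite (alternating_binS N (fun j => P.[a - j%:R * c])).
pose Q := P - (P \Po ('X - c%:P)).
have QE : Q = \sum_(i < N.+1) P`_i.+1 *: ('X^(i.+1) - ('X - c%:P) ^+ i.+1).
  have PE : P = \sum_(i < N.+2) P`_i *: 'X^i.
    apply/polyP => i; rewrite -poly_def coef_poly; case: ltnP => // Ni.
    by rewrite nth_default// (leq_trans sP).
  rewrite /Q {1 2}PE raddf_sum -sumrB big_ord_recl /= !comp_polyZ !comp_Xn_poly !expr0 subrr add0r.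
  by apply: eq_bigr => i _; rewrite comp_polyZ comp_Xn_poly scalerBr.
under eq_bigr => j _.
  have -> : P.[a - j%:R * c] - P.[a - j.+1%:R * c] = Q.[a - j%:R * c].
    rewrite /Q !hornerE horner_comp !hornerE; congr (_ - P.[_]).
    rewrite -[j.+1]addn1 natrD; ring.
  over.
rewrite IHN.
  rewrite QE coef_sum big_ord_recr /= big1 ?add0r => [|i _]; last first.
    rewrite coefZ; have [sz _] := size_XsubX_subC c i.
    by rewrite [X in _ * X]nth_default ?mulr0//; apply: leq_trans sz _.
  by rewrite coefZ (size_XsubX_subC c N).2 factS natrM exprS; ring.
rewrite QE; apply: (leq_trans (size_sum _ _ _)); apply/bigmax_leqP => i _.
rewrite (leq_trans (size_scale_leq _ _))//.
by have [sz _] := size_XsubX_subC c i; apply: leq_trans sz _.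
Qed.

End EhrhartPolynomial.

(** * Growth and alternating sums of the counting function *)

Section EhrhartCount.
Variables (R : realFieldType) (N : nat) (t : seq nat) (H : nat -> nat).
Hypothesis tN : all (fun u => u <= N)%N t.
Hypothesis H_count : forall k, H k = (\sum_(u <- t) nb_tuples_from N.+1 u k)%N.

Let P : {poly R} := \sum_(u <- t) rising R N u.

Let P_nat k : P.[k%:R] = N`!%:R * (H k)%:R.
Proof.
rewrite horner_sum H_count natr_sum mulr_sumr big_seq [RHS]big_seq.
apply: eq_bigr => u ut; rewrite rising_nat//.
by rewrite (leq_trans (allP tN u ut))// leq_addr.
Qed.

Lemma count_bounds k : (N <= k)%N ->
  (size t)%:R * (k%:R - N%:R) ^+ N <= N`!%:R * (H k)%:R :> R /\
  N`!%:R * (H k)%:R <= (size t)%:R * (k%:R + N%:R) ^+ N :> R.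
Proof.
move=> Nk; have kN : 0 <= k%:R - N%:R :> R by rewrite subr_ge0 ler_nat.
have b u : u \in t -> (k%:R - N%:R) ^+ N <= (rising R N u).[k%:R] :> R /\
                      (rising R N u).[k%:R] <= (k%:R + N%:R) ^+ N :> R.
  move=> /(allP tN) uN; rewrite horner_rising.
  have powE (x : R) : x ^+ N = \prod_(i < N) x by rewrite prodr_const card_ord.
  rewrite !powE.
  have u_le : u%:R <= N%:R :> R by rewrite ler_nat.
  have u_ge : 0 <= u%:R :> R by [].
  split; apply: ler_prod => i _.
    have : 0 <= i.+1%:R :> R by [].
    by rewrite kN /=; lra.
  have : i.+1%:R <= N%:R :> R by rewrite ler_nat.
  have : 0 <= i.+1%:R :> R by [].
  by move=> ? ?; apply/andP; split; lra.
rewrite -P_nat horner_sum !mulr_natl -!sum1_size -!sumrMnr !big_seq.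
by split; apply: ler_sum => u /b[].
Qed.

Lemma count_alternating_sum d :
  (forall k, H k = (\sum_(u <- t) nb_tuples_from N.+1 (N.+1 - u) (k + d))%N) ->
  (0 < d)%N -> odd N = ~~ odd d -> let n := (N %/ 2)%N in
  \sum_(0 <= m < n.+1) (-1) ^+ (n + m) *
     ('C(N, n - m)%:R + (-1) ^+ d * 'C(N, n + m + 1)%:R) * (H (m * d))%:R =
  (size t)%:R * d%:R ^+ N :> R.
Proof.
move=> H_count' d0 Nd n.
have P_opp k : P.[- (k + d)%:R] = (-1) ^+ N * (N`!%:R * (H k)%:R).
  rewrite horner_sum H_count' natr_sum !mulr_sumr big_seq [RHS]big_seq.
  apply: eq_bigr => u /(allP tN) uN; rewrite rising_opp ?rising_nat//; last exact: leqW.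
  by lia.
have sP : (size P <= N.+1)%N.
  by apply: (leq_trans (size_sum _ _ _)); apply/bigmax_leqP_seq => u _ _; rewrite size_rising.
have PN : P`_N = (size t)%:R.
  rewrite coef_sum -sum1_size natr_sum; apply: eq_bigr => u _.
  by have := rising_monic R N u; rewrite monicE lead_coefE size_rising => /eqP.
have := finite_difference ((n * d)%:R) (d%:R) sP; rewrite PN.
(* The range is extended to 2n + 2 terms so that it splits into two halves of equal length; for N =
   2n the extra term has binomial coefficient 0. *)
have -> : \sum_(j < N.+1) (-1) ^+ j * 'C(N, j)%:R * P.[(n * d)%:R - j%:R * d%:R] =
    \sum_(0 <= j < n.+1 + n.+1) (-1) ^+ j * 'C(N, j)%:R * P.[(n * d)%:R - j%:R * d%:R].
  rewrite big_mkord (big_ord_widen (n.+1 + n.+1)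
    (fun j => (-1) ^+ j * 'C(N, j)%:R * P.[(n * d)%:R - j%:R * d%:R])); last by rewrite /n; lia.
  rewrite big_mkcond; apply: eq_bigr => j _; case: ltnP => // Nj.
  by rewrite bin_small// mulr0 mul0r.
have shift (F : nat -> R) : \sum_(n.+1 <= j < n.+1 + n.+1) F j = \sum_(0 <= j < n.+1) F (j + n.+1)%N.
  by rewrite -{1}[n.+1]add0n big_addn addnK.
rewrite (big_cat_nat (n := n.+1)) ?leq_addr//= shift big_nat_rev /=.
rewrite -big_split /= => e.
have N0 : N`!%:R != 0 :> R by rewrite pnatr_eq0 -lt0n fact_gt0.
apply: (mulfI N0); transitivity (N`!%:R * d%:R ^+ N * (size t)%:R : R); last by ring.
rewrite -e mulr_sumr; apply: eq_big_nat => m; rewrite ltnS => /andP[_ mn].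
rewrite add0n subSS.
have -> : (n * d)%:R - (n - m)%:R * d%:R = (m * d)%:R :> R.
  by rewrite natrB// !natrM; ring.
have -> : (n * d)%:R - (m + n.+1)%:R * d%:R = - (m * d + d)%:R :> R.
  by rewrite !natrD !natrM -addn1 natrD; ring.
rewrite P_nat P_opp addn1 addnS (addnC m n) exprS.
have -> : (-1) ^+ (n - m) = (-1) ^+ (n + m) :> R.
  by rewrite -signr_odd oddB// -oddD signr_odd.
(* The mirrored half carries the sign (-1)^(n+m+1) of the difference and the sign (-1)^N of
   reciprocity; their product is (-1)^(n+m) (-1)^d. *)
have -> : (-1) ^+ N = - (-1) ^+ d :> R.
  by rewrite -signr_odd Nd -[in RHS]signr_odd; case: (odd d); rewrite ?expr0 ?expr1 ?opprK.
ring.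
Qed.

End EhrhartCount.

(** * Lattice frames of the Birkhoff polytope *)

Local Open Scope classical_set_scope.

Lemma birkhoffE (R : realType) d (X : 'M[R]_d) :
  birkhoff R d X <-> (forall i j, 0 <= X i j) /\ line_sums X 1.
Proof. by split=> [[? ? ?]|[? []]]; split. Qed.

(** The matrix J with all entries 1/d is positive, so a short step from J towards any X with line
    sums 1 stays in the polytope at some Y; then X lies on the line through J and Y. *)
Lemma affine_hull_birkhoff (R : realType) d : (0 < d)%N ->
  affine_hull (birkhoff R d) = [set X | line_sums X 1].
Proof.
move=> d0; apply/seteqP; split=> [_ [n [c [p [hp c1 ->]]]]|X X1].
  have {}hp i : line_sums (p i) 1 by have /birkhoffE[] := hp i.
  split=> i; under eq_bigr do rewrite summxE.
    rewrite exchange_big /= -[RHS]c1; apply: eq_bigr => k _.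
    by under eq_bigr do rewrite mxE; rewrite -mulr_sumr (proj1 (hp k)) mulr1.
  rewrite exchange_big /= -[RHS]c1; apply: eq_bigr => k _.
  by under eq_bigr do rewrite mxE; rewrite -mulr_sumr (proj2 (hp k)) mulr1.
pose J : 'M[R]_d := const_mx d%:R^-1.
have dn0 : d%:R != 0 :> R by rewrite pnatr_eq0 -lt0n.
have J1 : line_sums J 1 by have := line_sums_const d (d%:R^-1 : R); rewrite divff.
have [e e0 he] := small_enough [seq (d%:R^-1 : R, X a.1 a.2 - J a.1 a.2) | a <- enum {: 'I_d * 'I_d}].
pose Y := J + e *: (X - J).
have YB : birkhoff R d Y.
  apply/birkhoffE; split=> [i j|]; last first.
    rewrite -[1](addr0 1) -(mulr0 e) -(subrr 1).
    by apply: line_sumsD => //; apply: line_sumsZ; apply: line_sumsB.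
  have := he d%:R^-1 (X i j - J i j); rewrite invr_eq0 dn0.
  have -> : (d%:R^-1 : R, X i j - J i j) \in [seq (d%:R^-1 : R, X a.1 a.2 - J a.1 a.2) | a <- enum {: 'I_d * 'I_d}].
    by apply/mapP; exists (i, j); rewrite ?mem_enum.
  move=> /(_ isT isT); rewrite [X in _ < X]ger0_norm ?invr_ge0// ltr_norml !mxE => /andP[]; lra.
have JB : birkhoff R d J by apply/birkhoffE; split=> // i j; rewrite mxE invr_ge0.
exists 2%N, (fun i => if i == ord0 then 1 - e^-1 else e^-1), (fun i => if i == ord0 then J else Y); split.
- by move=> i; case: ifP.
- by rewrite !big_ord_recl big_ord0 /= addr0 subrK.
- rewrite !big_ord_recl big_ord0 /= addr0 /Y scalerDr scalerA mulVf ?gt_eqF// scale1r.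
  by rewrite addrA -scalerDl subrK scale1r addrC subrK.
Qed.

Section FrameExists.
Variables (R : realType) (n : nat).

Definition std_basis (k : 'I_(n * n)) : 'M[R]_(1 + n) :=
  zls_emb R n *m vec_mx (delta_mx 0 k) *m (zls_emb R n)^T.

Lemma std_chartE t :
  affine_chart 1%:M std_basis t = 1%:M + zls_emb R n *m vec_mx t *m (zls_emb R n)^T.
Proof.
rewrite /affine_chart; congr (_ + _).
rewrite {2}[t]row_sum_delta linear_sum mulmx_sumr mulmx_suml.
by apply: eq_bigr => k _; rewrite /std_basis linearZ -scalemxAr -scalemxAl.
Qed.

Lemma zls_emb_int m (A : 'M[R]_(n, m)) : (forall i j, A i j \is a Num.int) ->
  forall i j, (zls_emb R n *m A) i j \is a Num.int.
Proof.
move=> Aint i j; rewrite mxE rpred_sum// => k _; rewrite rpredM// mxE.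
by case: splitP => l _; rewrite mxE ?rpredN ?rpred1 ?rpred_nat.
Qed.

Lemma std_frame : lattice_frame (birkhoff R (1 + n)) 1%:M std_basis.
Proof.
have hull := affine_hull_birkhoff R (ltn0Sn n).
have chart1 t : line_sums (affine_chart 1%:M std_basis t) 1.
  rewrite std_chartE -[X in line_sums _ X]addr0.
  by apply: line_sumsD (line_sums_1 _ _) (zls_emb_sums _).
have chartK t : mxvec (zls_proj R n *m (affine_chart 1%:M std_basis t - 1%:M) *m (zls_proj R n)^T) = t.
  by rewrite std_chartE addrC addKr zls_inj vec_mxK.
have chartS (X : 'M[R]_(1 + n)) : line_sums X 1 ->
    affine_chart 1%:M std_basis (mxvec (zls_proj R n *m (X - 1%:M) *m (zls_proj R n)^T)) = X.
  move=> X1; rewrite std_chartE mxvecK zls_surj; first by rewrite addrC subrK.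
  by rewrite -(subrr 1); apply: line_sumsB => //; apply: line_sums_1.
split.
- by move=> t t' e; rewrite -(chartK t) e chartK.
- rewrite hull; apply/seteqP; split=> [_ [t _ <-]|X X1]; first exact: chart1.
  by exists (mxvec (zls_proj R n *m (X - 1%:M) *m (zls_proj R n)^T)) => //; apply: chartS.
- rewrite hull; apply/seteqP; split=> [_ [t tint <-]|X [X1 Xint]].
    split; [exact: chart1|move=> i j]; rewrite std_chartE mxE rpredD//; first by rewrite mxE rpred_nat.
    rewrite -[_ *m _]trmxK trmx_mul trmxK mxE; apply: zls_emb_int => {}j {}i.
    rewrite mxE; apply: zls_emb_int => {}i {}j; rewrite mxE; exact: tint.
  exists (mxvec (zls_proj R n *m (X - 1%:M) *m (zls_proj R n)^T)); last exact: chartS.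
  move=> i k; rewrite ord1; case/mxvec_indexP: k => k l; rewrite mxvecE.
  rewrite mxE rpred_sum// => j _; rewrite rpredM//.
    rewrite mxE rpred_sum// => j' _; rewrite rpredM//.
      by rewrite mxE; case: splitP => u _; rewrite mxE ?rpred0 ?rpred_nat.
    by rewrite !mxE rpredB// rpred_nat.
  by rewrite !mxE; case: splitP => u _; rewrite mxE ?rpred0 ?rpred_nat.
Qed.

End FrameExists.

Section Frame.
Variables (R : realType) (d m : nat) (p0 : 'M[R]_d) (b : 'I_m -> 'M[R]_d).
Hypothesis d_gt0 : (0 < d)%N.
Hypothesis frame : lattice_frame (birkhoff R d) p0 b.

Local Notation chart := (affine_chart p0 b).

Lemma chart_sums t : line_sums (chart t) 1.
Proof.
have [_ ran _] := frame.
have : range chart (chart t) by exists t.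
by rewrite ran affine_hull_birkhoff.
Qed.

Lemma chart_surj X : line_sums X 1 -> exists t, chart t = X.
Proof.
move=> X1; have [_ ran _] := frame.
have : range chart X by rewrite ran affine_hull_birkhoff.
by case=> t _ <-; exists t.
Qed.

Lemma chart_inj : injective chart. Proof. by have [] := frame. Qed.

Lemma chart_int t : integer_points R 1 m t -> integer_points R d d (chart t).
Proof.
move=> tint; have [_ _ im] := frame.
have : (chart @` integer_points R 1 m) (chart t) by exists t.
by rewrite im => -[].
Qed.

Lemma chart_intP t : integer_points R d d (chart t) -> integer_points R 1 m t.
Proof.
move=> ctint; have [_ _ im] := frame.
have : (affine_hull (birkhoff R d) `&` integer_points R d d) (chart t).
  by rewrite affine_hull_birkhoff//; split=> //; apply: chart_sums.
by rewrite -im => -[t' t'int /chart_inj <-].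
Qed.

Lemma chart0 : chart 0 = p0.
Proof. by rewrite /affine_chart big1 ?addr0// => i _; rewrite mxE scale0r. Qed.

Lemma chart_comb c t t' : chart (c *: t + t') = c *: (chart t - p0) + chart t'.
Proof.
rewrite /affine_chart (addrC p0 (\sum_i t 0 i *: b i)) addrK addrCA scaler_sumr -big_split /=.
by congr (_ + _); apply: eq_bigr => i _; rewrite !mxE scalerDl scalerA.
Qed.

Lemma p0_sums : line_sums p0 1. Proof. by rewrite -chart0; apply: chart_sums. Qed.

Lemma p0_int : integer_points R d d p0.
Proof. by rewrite -chart0; apply: chart_int => i j; rewrite mxE. Qed.

Lemma chartE t i j : chart t i j = p0 i j + \sum_k t 0 k * b k i j.
Proof. by rewrite mxE summxE; congr (_ + _); apply: eq_bigr => k _; rewrite mxE. Qed.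

Lemma chart_left_inverse : exists G : 'M[R]_(d * d, m),
  forall t, mxvec (chart t - p0) *m G = t.
Proof.
pose B : 'M[R]_(m, d * d) := \matrix_k mxvec (b k).
have BE (t : 'rV_m) : t *m B = mxvec (chart t - p0).
  rewrite /affine_chart addrC addKr linear_sum mulmx_sum_row.
  by apply: eq_bigr => k _; rewrite rowK linearZ.
have Bfree : row_free B.
  apply: inj_row_free => t; rewrite BE => /(canRL mxvecK); rewrite linear0 => /eqP.
  by rewrite subr_eq0 -{2}chart0 => /eqP/chart_inj.
by exists (pinvmx B) => t; rewrite -BE mulmxKp.
Qed.

Definition magic_enum k : seq 'M[nat]_d := enum_fset (fset_set (magic_squares d k)).

Lemma mem_magic_enum k A : (A \in magic_enum k) <-> line_sums A k.
Proof.
have fin : finite_set (magic_squares d k).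
  have -> : magic_squares d k = [set A | half_open (const_mx 1 : 'M[rat]_d) k A].
    apply/seteqP; split=> B; last by case.
    by move=> hB; split=> // i j; rewrite mxE// => /eqP; rewrite oner_eq0.
  by have [] := nb_half_openE (const_mx 1 : 'M[rat]_d) (leqnn k).
rewrite /magic_enum (in_fset_set fin).
by split=> [/set_mem|h]; last exact/mem_set.
Qed.

Lemma size_magic_enum k : size (magic_enum k) = nb_magic_squares d k.
Proof. by []. Qed.

(* Writing t = (z + r) / k with z integral and 0 <= r < 1, k chart(t) differs from the integral matrix *)
(* with coordinates z by at most c in each entry. *)
Lemma outer_le_count : exists c : nat, forall k, (0 < k)%N ->
  (lebesgue_outer (chart @^-1` birkhoff R d) <=
   ((nb_magic_squares d (k + d * c))%:R / k%:R ^+ m)%:E)%E.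
Proof.
have [G GK] := chart_left_inverse.
(* Adding c to all entries outweighs the rounding error and makes the integral matrix nonnegative;
   the price is the larger line sum k + d c. *)
have [c hc] : exists c : nat, forall i j, \sum_k `|b k i j| <= c%:R.
  exists (Num.truncn (\sum_i \sum_j \sum_k `|b k i j|)).+1 => i j.
  apply/ltW/(le_lt_trans _ (truncnS_gt _)).
  rewrite (bigD1 i) //= (bigD1 j) //= -addrA lerDl addr_ge0// ?sumr_ge0// => *.
    by rewrite sumr_ge0.
  by rewrite sumr_ge0// => *; rewrite sumr_ge0.
exists c => k k0; have kR0 : 0 < k%:R :> R by rewrite ltr0n.
set s := magic_enum (k + d * c).
pose toR (A : 'M[nat]_d) : 'M[R]_d := map_mx (GRing.natmul 1) A.
(* This recovers z / k, the lower corner of the cube of side 1/k around t, from the magic square A =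
   c + k p0 + (chart z - p0). *)
pose corner A := k%:R^-1 *: (mxvec (toR A - const_mx c%:R - k%:R *: p0) *m G).
pose lo j := corner (nth 0 s j); pose hi j := lo j + const_mx k%:R^-1.
have hiE j i : hi j 0 i - lo j 0 i = k%:R^-1.
  by rewrite /hi mxE addrAC subrr add0r mxE.
apply: ereal_inf_lbound; exists `I_(size s), lo, hi; split.
- by move=> j i; rewrite !mxE lerDl invr_ge0.
- move=> t /birkhoffE[tpos t1].
  pose z : 'rV[R]_m := \row_i (Num.floor (k%:R * t 0 i))%:~R.
  have zint : integer_points R 1 m z by move=> i j; rewrite mxE intr_int.
  pose X := const_mx c%:R + (k%:R *: p0 + (chart z - p0)).
  have X0E i j : X i j = c%:R + (k%:R * p0 i j + (chart z i j - p0 i j)).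
    by rewrite /X; move: (chart z) => Y; rewrite !mxE.
  have XE i j : X i j = c%:R + k%:R * chart t i j - \sum_l (k%:R * t 0 l - z 0 l) * b l i j.
    rewrite X0E !chartE mulrDr.
    under [\sum_l (_ - _) * _]eq_bigr do rewrite mulrBl -mulrA.
    rewrite sumrB -mulr_sumr; ring.
  have zt l : 0 <= k%:R * t 0 l - z 0 l < 1.
    by rewrite mxE; have /andP[] := floor_itv (k%:R * t 0 l); rewrite intrD => *; apply/andP; split; lra.
  have Xnat i j : X i j \is a Num.nat.
    rewrite natrEint; apply/andP; split.
      rewrite X0E; have := p0_int i j; have := chart_int zint i j => ? ?.
      by rewrite !rpredD ?rpredN ?rpredM ?rpred_nat.
    rewrite XE; have : \sum_l (k%:R * t 0 l - z 0 l) * b l i j <= c%:R.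
      apply: le_trans (hc i j); apply: ler_sum => l _; apply: le_trans (ler_norm _) _.
      rewrite normrM; have /andP[h1 h2] := zt l; rewrite ger0_norm// ler_piMl//; exact: ltW.
    have : 0 <= k%:R * chart t i j by rewrite mulr_ge0.
    lra.
  pose A : 'M[nat]_d := map_mx (@Num.truncn R) X.
  have AX : toR A = X by apply/matrixP => i j; rewrite [LHS]mxE [A i j]mxE truncK.
  have X1 : line_sums X (k + d * c)%:R.
    have := line_sumsD (line_sums_const d c%:R)
      (line_sumsD (line_sumsZ k%:R p0_sums) (line_sumsB (chart_sums z) p0_sums)).
    by rewrite mulr1 subrr addr0 -natrM -natrD addnC.
  have As : A \in s.
    apply/mem_magic_enum; split=> i; apply/eqP; rewrite -(eqr_nat R) natr_sum.
      by rewrite -(proj1 X1 i) -AX; apply/eqP; apply: eq_bigr => j _; rewrite [RHS]mxE.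
    by rewrite -(proj2 X1 i) -AX; apply/eqP; apply: eq_bigr => j _; rewrite [RHS]mxE.
  have zE : corner A = k%:R^-1 *: z.
    rewrite /corner AX; congr (_ *: _); rewrite -[RHS]GK; congr (mxvec _ *m _).
    by rewrite /X [const_mx _ + _]addrC addrK addrC addKr.
  exists (index A s); first by rewrite /= index_mem.
  move=> i; rewrite /hi /lo nth_index// zE !mxE.
  have := zt i; rewrite mxE; move: (_%:~R) => f /andP[h1 h2].
  apply/andP; split; rewrite -(ler_pM2l kR0).
    rewrite mulVKf ?gt_eqF//; lra.
  rewrite mulrDr mulVKf ?gt_eqF// divff ?gt_eqF//; lra.
- rewrite esum_fset//; last first.
    by move=> j _; rewrite lee_fin prodr_ge0// => i _; rewrite hiE invr_ge0.
  rewrite -fsbig_ord /= (eq_bigr (fun=> (k%:R ^- m)%:E)); last first.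
    move=> j _; congr EFin; rewrite (eq_bigr (fun=> k%:R^-1)).
      by rewrite prodr_const card_ord exprVn.
    by move=> i _; apply: hiE.
  by rewrite sumEFin sumr_const card_ord mulr_natl.
Qed.

End Frame.

(** * The volume *)

(** Each coordinate of z exceeds the ceiling of x_i by a natural number that is at most the integer
    part of y_i - x_i. *)
Lemma size_int_points_le (R : realType) N (S : seq 'rV[R]_N) (x y : 'I_N -> R) :
  uniq S -> (forall i, x i <= y i) ->
  (forall z, z \in S -> integer_points R 1 N z /\ forall i, x i <= z 0 i <= y i) ->
  (size S)%:R <= \prod_i (y i - x i + 1).
Proof.
move=> uS xy hS; pose n i := (Num.truncn (y i - x i)).+1; pose M := (\sum_i n i)%N.
have nM i : (n i <= M)%N by rewrite /M (bigD1 i) //= leq_addr.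
pose r (z : 'rV[R]_N) i : nat := absz (Num.floor (z ord0 i) - Num.ceil (x i)).
pose g z : {ffun 'I_N -> 'I_M.+1} := [ffun i => inord (r z i)].
have rE (z : 'rV[R]_N) i : z \in S -> (r z i)%:R = z ord0 i - (Num.ceil (x i))%:~R.
  move=> /hS[zint /(_ i)/andP[xz _]]; have /intrP[k zk] := zint ord0 i.
  rewrite /r zk intrKfloor -intrB natr_absz ger0_norm// subr_ge0.
  by rewrite -(@intrKceil R k) -zk le_ceil_tmp.
have rn z i : z \in S -> (r z i < n i)%N.
  move=> zS; have /hS[_ /(_ i)/andP[_ zy]] := zS.
  rewrite ltnS truncn_ge_nat ?subr_ge0// rE//.
  by have := ceil_ge (x i); lra.
pose Q i := [pred q : 'I_M.+1 | (q < n i)%N].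
have gQ z : z \in S -> g z \in family Q.
  move=> zS; apply/familyP => i; rewrite ffunE inE inordK ?rn//.
  by rewrite ltnS ltnW// (leq_trans (rn z i zS)).
have gi : {in S &, injective g}.
  move=> z z' zS z'S /ffunP e; apply/rowP => i.
  have := e i; rewrite !ffunE => /(congr1 val) /=.
  rewrite !inordK ?ltnS; try by rewrite ltnW// (leq_trans (rn _ i _)).
  by move=> ee; have := rE z i zS; rewrite ee rE// => /addIr.
have : (size S <= \prod_i n i)%N.
  have -> : (\prod_i n i = #|family Q|)%N.
    rewrite -sum1_card (eq_bigr (fun f : {ffun 'I_N -> 'I_M.+1} => \prod_(i < N) 1)%N); last first.
      by move=> *; rewrite big1.
    rewrite -(bigA_distr_big_dep Q (fun _ _ => 1%N)); apply: eq_bigr => i _.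
    rewrite -{1}[n i]card_ord -sum1_card (big_ord_widen M.+1 (fun=> 1%N)) ?(leq_trans (nM i))//.
  rewrite cardE -(size_map g); apply: uniq_leq_size; first by rewrite map_inj_in_uniq.
  by move=> _ /mapP[z zS ->]; rewrite mem_enum gQ.
rewrite -(ler_nat R) => /le_trans; apply; rewrite natr_prod; apply: ler_prod => i _.
by rewrite ler0n /n -natr1 lerD2r truncn_le subr_ge0 xy.
Qed.

Lemma horner_near0 (R : realType) (p : {poly R}) (e : R) : 0 < e ->
  exists2 r : R, 0 < r & forall x, `|x| < r -> `|p.[x] - p.[0]| < e.
Proof.
move=> e0; have : horner p x @[x --> (0 : R)] --> p.[0] by exact: continuous_horner.
move=> /cvgrPdist_lt/(_ e e0)/nbhs_ballP[r /= r0 hr].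
by exists r => // x xr; rewrite distrC; apply: hr; rewrite /ball /= sub0r normrN.
Qed.

Lemma sum_half_pow_le1 (R : realFieldType) (s : seq nat) : uniq s ->
  \sum_(k <- s) (2^-1 : R) ^+ k.+1 <= 1.
Proof.
move=> us; pose M := (\max_(k <- s) k).+1.
have sM k : k \in s -> (k < M)%N by move=> ks; rewrite ltnS (big_rem k)//= leq_maxl.
have -> : \sum_(k <- s) (2^-1 : R) ^+ k.+1 = \sum_(k < M | (k : nat) \in s) (2^-1 : R) ^+ k.+1.
  rewrite -(big_mkord (fun k => k \in s) (fun k => (2^-1 : R) ^+ k.+1)) -big_filter.
  apply: perm_big; apply: uniq_perm; rewrite ?filter_uniq ?iota_uniq// => k.
  by rewrite mem_filter mem_index_iota; case ks : (k \in s); rewrite //= sM.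
have le1 : \sum_(k < M) (2^-1 : R) ^+ k.+1 <= 1.
  suff -> : \sum_(k < M) (2^-1 : R) ^+ k.+1 = 1 - 2^-1 ^+ M by rewrite gerBl exprn_ge0.
  elim: M {sM} => [|M IH]; first by rewrite big_ord0 expr0 subrr.
  rewrite big_ord_recr /= IH exprS; lra.
apply: le_trans le1; rewrite [leRHS](bigID (fun k : 'I_M => (k : nat) \in s)) /= lerDl.
by apply: sumr_ge0 => k _; rewrite exprn_ge0.
Qed.

(** * Lower bound of the outer measure *)

Section LowerBound.
Variables (R : realType) (d m : nat) (p0 : 'M[R]_d) (b : 'I_m -> 'M[R]_d).
Hypothesis d_gt0 : (0 < d)%N.
Hypothesis frame : lattice_frame (birkhoff R d) p0 b.

Local Notation chart := (affine_chart p0 b).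

Lemma chart_coord_continuous i j : continuous (fun t : 'rV[R]_m => chart t i j).
Proof.
under eq_fun do rewrite chartE.
move=> t; have F : Filter (nbhs t) by exact: nbhs_filter.
have c1 : (fun x : 'rV[R]_m => p0 i j) x @[x --> t] --> p0 i j by exact: (@cvg_cst _ (p0 i j) _ _ F).
have c2 : (fun x : 'rV[R]_m => \sum_k x 0 k * b k i j) x @[x --> t] --> \sum_k t 0 k * b k i j.
  apply: (cvg_big add_continuous F) => k _.
  apply: (@cvgM _ _ _ F); last exact: (@cvg_cst _ (b k i j) _ _ F).
  exact: coord_continuous.
exact: (cvgD c1 c2).
Qed.

(** Closed because the chart is continuous; bounded because the entries of a doubly stochastic
    matrix are at most 1 and t depends linearly on them through [chart_left_inverse]. *)
Lemma chart_preimage_compact : compact (chart @^-1` birkhoff R d).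
Proof.
have [G GK] := chart_left_inverse frame.
pose M (k : 'I_m) : R := \sum_e (1 + `|mxvec p0 0 e|) * `|G e k|.
have bd : compact [set t : 'rV[R]_m | forall k, `[- M k, M k]%classic (t ord0 k)].
  by apply: (rV_compact (A := fun k => `[- M k, M k]%classic)) => k; apply: segment_compact.
apply: subclosed_compact bd _; last first.
  move=> t /birkhoffE[t0 [t1 _]] k /=; rewrite in_itv /= -ler_norml -{1}(GK t) mxE.
  apply: (@le_trans _ _ (\sum_e `|mxvec (chart t - p0) 0 e * G e k|)).
    exact: ler_norm_sum.
  apply: ler_sum => e _.
  rewrite normrM ler_wpM2r//; case/mxvec_indexP: e => i j; rewrite !mxvecE.
  have -> : (chart t - p0) i j = chart t i j - p0 i j by move: (chart t) => Y; rewrite !mxE.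
  apply: (@le_trans _ _ (`|chart t i j| + `|p0 i j|)); first exact: ler_normB.
  rewrite lerD2r ger0_norm// -(t1 i) (bigD1 j) //= lerDl.
  exact: sumr_ge0.
have -> : chart @^-1` birkhoff R d =
    \bigcap_(e in [set: 'I_d * 'I_d]) ((fun t => chart t e.1 e.2) @^-1` [set x | 0 <= x]).
  apply/seteqP; split=> [t /birkhoffE[t0 _] e _|t ht]; first exact: t0.
  apply/birkhoffE; split; [move=> i j; exact: (ht (i, j))|exact: (chart_sums d_gt0 frame)].
apply: closed_bigI => e _; apply: preimage_closed; last exact: closed_ge.
by move=> t _; apply: chart_coord_continuous.
Qed.

(* z A is k times the coordinates of A / k. *)
Lemma magic_points k : (0 < k)%N -> exists z : 'M[nat]_d -> 'rV[R]_m,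
  [/\ {in magic_enum d k &, injective z},
      forall A, A \in magic_enum d k -> integer_points R 1 m (z A)
    & forall A, A \in magic_enum d k -> (chart @^-1` birkhoff R d) (k%:R^-1 *: z A)].
Proof.
move=> k0; have kn0 : k%:R != 0 :> R by rewrite pnatr_eq0 -lt0n.
pose toR (A : 'M[nat]_d) : 'M[R]_d := map_mx (GRing.natmul 1) A.
have /choice[t ht] : forall A, exists t, A \in magic_enum d k -> chart t = k%:R^-1 *: toR A.
  move=> A; have [/mem_magic_enum Ak|] := boolP (A \in magic_enum d k); last by exists 0.
  have [|t ht] := chart_surj d_gt0 frame (X := k%:R^-1 *: toR A); last by exists t.
  by have := line_sumsZ k%:R^-1 (line_sums_natr R Ak); rewrite mulVf.
exists (fun A => k%:R *: t A); split.
- move=> A B Ak Bk /(scalerI kn0) e.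
  have := ht A Ak; rewrite e ht// => /(scalerI (invr_neq0 kn0)) /matrixP AB.
  by apply/matrixP => i j; have := AB i j; rewrite !mxE => /eqP; rewrite eqr_nat => /eqP.
- move=> A Ak; apply: (chart_intP d_gt0 frame) => i j.
  rewrite -[_ *: _]addr0 chart_comb ht// chart0 scalerBr scalerA divff// scale1r.
  have := p0_int frame i j => ?.
  by rewrite !mxE !rpredD ?rpredN ?rpredM ?rpred_nat.
- move=> A Ak; rewrite /= scalerA mulVf// scale1r; apply/birkhoffE; rewrite ht//; split.
    by move=> i j; rewrite !mxE mulr_ge0 ?invr_ge0.
  have /mem_magic_enum As := Ak.
  by have := line_sumsZ k%:R^-1 (line_sums_natr R As); rewrite mulVf.
Qed.

(** The boxes are widened to open ones, at a total cost of at most e, and compactness leaves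
    finitely many of them. The points of the polytope with denominator k are then counted box by
    box. *)
Lemma count_le_cover (D : set nat) (lo hi : nat -> 'rV[R]_m) (e : R) : 0 < e ->
  (forall k i, lo k 0 i <= hi k 0 i) ->
  chart @^-1` birkhoff R d `<=` \bigcup_(k in D) box (lo k) (hi k) ->
  exists k0, forall k, (k0 < k)%N ->
   (((nb_magic_squares d k)%:R / k%:R ^+ m)%:E <=
     \esum_(k in D) (\prod_i (hi k 0 i - lo k 0 i))%:E + e%:E)%E.
Proof.
move=> e0 lohi cov; pose w k i := hi k 0 i - lo k 0 i.
have w0 k i : 0 <= w k i by rewrite subr_ge0.
(* Of the 3 h, 2 h widens the box on both sides, and the third h absorbs the + 1 of
   [size_int_points_le] once the denominator q satisfies q h >= 1. *)
have /choice[h hh] : forall k, exists h : R, 0 < h /\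
    \prod_i (w k i + 3 * h) <= \prod_i w k i + e * 2^-1 ^+ k.+1.
  move=> k; pose p : {poly R} := \prod_i ((w k i)%:P + 3 *: 'X).
  have pE x : p.[x] = \prod_i (w k i + 3 * x).
    by rewrite horner_prod; apply: eq_bigr => i _; rewrite !hornerE.
  have [|r r0 hr] := horner_near0 p (e := e * 2^-1 ^+ k.+1).
    by rewrite mulr_gt0// exprn_gt0.
  have r2 : 0 < r / 2 by rewrite divr_gt0.
  have rr : r / 2 < r by lra.
  exists (r / 2); split=> //; have := hr (r / 2); rewrite (gtr0_norm r2) => /(_ rr).
  rewrite !pE (eq_bigr (w k) (F1 := fun i => w k i + 3 * 0)) => [|i _]; last by rewrite mulr0 addr0.
  by rewrite ltr_distl => /andP[_ h]; apply: ltW.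
pose U k := [set x : 'rV[R]_m | forall i, lo k 0 i - h k < x 0 i < hi k 0 i + h k].
have Uopen k : open (U k).
  rewrite openE => x Ux; rewrite /interior.
  apply: (@filter_forall _ _ (fun i => [set y : 'rV[R]_m | lo k 0 i - h k < y 0 i < hi k 0 i + h k])
    _ (nbhs_filter x)) => i.
  have cc : (fun y : 'rV[R]_m => y 0 i) y @[y --> x] --> x 0 i := @coord_continuous R 1 m 0 i x.
  have : x 0 i \in `](lo k 0 i - h k), (hi k 0 i + h k)[%R by rewrite in_itv; exact: Ux.
  move=> /near_in_itvoo.
  move=> /cc; apply: (@filterS _ _ (nbhs_filter x)) => y.
  by rewrite /= in_itv.
have := chart_preimage_compact; rewrite compact_cover => /(_ nat D U (fun k _ => Uopen k)).
case=> [t /cov[k Dk tk]|F FD Fcov].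
  exists k => // i; have /andP[h1 h2] := tk i; have [h0 _] := hh k.
  by apply/andP; split; lra.
pose k0 := (\sum_(k <- F) (Num.truncn (h k)^-1).+1)%N.
exists k0 => q kq; have q0 : (0 < q)%N by apply: leq_ltn_trans kq.
have qR : 0 < q%:R :> R by rewrite ltr0n.
have qn0 : q%:R != 0 :> R by rewrite gt_eqF.
have qh k : k \in F -> 1 <= q%:R * h k.
  move=> kF; have [h0 _] := hh k; rewrite -ler_pdivrMr// div1r.
  apply: le_trans (ltW (truncnS_gt _)) _; rewrite ler_nat; apply: leq_trans (ltnW kq).
  by rewrite /k0 (big_rem k)//= leq_addr.
have [z [zi zint zK]] := magic_points q0.
pose S k := [seq z A | A <- magic_enum d q & `[< U k (q%:R^-1 *: z A) >]].
have sizeS k : k \in F -> (size (S k))%:R <= q%:R ^+ m * \prod_i (w k i + 3 * h k).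
  move=> kF; have [h0 _] := hh k.
  have -> : q%:R ^+ m * \prod_i (w k i + 3 * h k) = \prod_i (q%:R * (w k i + 3 * h k)).
    by rewrite big_split /= prodr_const card_ord.
  apply: le_trans (size_int_points_le (x := fun i => q%:R * (lo k 0 i - h k))
    (y := fun i => q%:R * (hi k 0 i + h k)) _ _ _) _.
  - rewrite map_inj_in_uniq ?filter_uniq ?fset_uniq// => A B.
    by rewrite !mem_filter => /andP[_ A1] /andP[_ B1]; apply: zi.
  - move=> i; rewrite ler_pM2l//; have := lohi k i; lra.
  - move=> _ /mapP[A + ->]; rewrite mem_filter => /andP[/asboolP UA Aq].
    split=> [|i]; first exact: zint.
    have := UA i; rewrite mxE => /andP[/ltW h1 /ltW h2].
    rewrite -[z A 0 i](mulVKf qn0); apply/andP; split; by rewrite ler_pM2l.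
  apply: ler_prod => i _; have := qh k kF; have := w0 k i; rewrite /w => ? ?.
  apply/andP; split; last by lra.
  have : 0 <= q%:R * (hi k 0 i + h k - (lo k 0 i - h k)) by rewrite mulr_ge0//; lra.
  lra.
have sizeH : (nb_magic_squares d q <= \sum_(k <- F) size (S k))%N.
  rewrite -size_magic_enum.
  under eq_bigr do rewrite size_map size_filter -sum1_count big_mkcond /=.
  rewrite exchange_big /= -sum1_size big_seq [leqRHS]big_seq; apply: leq_sum => A Aq.
  have [k /= kF Uk] := Fcov _ (zK A Aq).
  by rewrite (big_rem k) //= asboolT.
have : (nb_magic_squares d q)%:R / q%:R ^+ m <= \sum_(k <- F) \prod_i w k i + e :> R.
  rewrite ler_pdivrMr ?exprn_gt0//.
  apply: (@le_trans _ _ (\sum_(k <- F) (size (S k))%:R)); first by rewrite -natr_sum ler_nat.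
  rewrite mulrC; apply: (@le_trans _ _ (\sum_(k <- F) q%:R ^+ m * \prod_i (w k i + 3 * h k))).
    by rewrite big_seq [leRHS]big_seq; apply: ler_sum => k; apply: sizeS.
  rewrite -mulr_sumr ler_pM2l ?exprn_gt0//.
  apply: (@le_trans _ _ (\sum_(k <- F) (\prod_i w k i + e * 2^-1 ^+ k.+1))).
    by apply: ler_sum => k _; have [] := hh k.
  rewrite big_split /= lerD2l -mulr_sumr; apply: ler_piMr; first exact: ltW.
  by apply: sum_half_pow_le1; apply: fset_uniq.
rewrite -lee_fin => /le_trans; apply; rewrite EFinD leeD2r//.
apply: esum_ge; exists [set` F].
  split; first exact: finite_fset.
  by move=> k /= /FD; rewrite inE.
by rewrite -fsbig_seq ?fset_uniq// sumEFin.
Qed.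

End LowerBound.

(** With L the claimed value, H_d(k) / k^m is at least L (1 - m/k)^m, and H_d(k + d c) / k^m is at
    most L (1 + (d c + m)/k)^m. Both bounds tend to L, by continuity of a polynomial at 0. *)
Lemma birkhoff_volume (R : realType) d (t : seq nat) (m := ((d - 1) ^ 2)%N)
    (p0 : 'M[R]_d) (b : 'I_m -> 'M[R]_d) :
  (0 < d)%N -> lattice_frame (birkhoff R d) p0 b ->
  all (fun u => u <= m)%N t -> ehrhart_seq d t ->
  lebesgue_outer (affine_chart p0 b @^-1` birkhoff R d) = ((size t)%:R / m`!%:R)%:E.
Proof.
move=> d0 frame tm ht; set L := _ / _.
have bounds k : (m <= k)%N -> (size t)%:R * (k%:R - m%:R) ^+ m <= m`!%:R * (nb_magic_squares d k)%:R :> R /\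
    m`!%:R * (nb_magic_squares d k)%:R <= (size t)%:R * (k%:R + m%:R) ^+ m :> R.
  by apply: count_bounds => // k'; have [] := ht k'.
have m0 : 0 < m`!%:R :> R by rewrite ltr0n fact_gt0.
apply/le_anti/andP; split; last first.
  apply: le_ereal_inf_tmp => _ [D [lo [hi [lohi cov ->]]]].
  apply/lee_addgt0Pr => e e0; have e20 : 0 < e / 2 by rewrite divr_gt0.
  have [k0 hk0] := count_le_cover d0 frame e20 lohi cov.
  have [r r0 hr] := horner_near0 (L *: (1 - 'X) ^+ m) e20.
  pose k := (maxn (maxn k0 m) (Num.truncn (m%:R / r))).+1.
  have kR : 0 < k%:R :> R by rewrite ltr0n.
  have kr : m%:R / k%:R < r.
    rewrite ltr_pdivrMr// mulrC -ltr_pdivrMr//; apply: lt_le_trans (truncnS_gt _) _.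
    by rewrite ler_nat ltnS leq_maxr.
  have mk : (m <= k)%N by rewrite leqW// leq_max leq_max leqnn orbT.
  have Lk : L - e / 2 <= (nb_magic_squares d k)%:R / k%:R ^+ m.
    have := hr (m%:R / k%:R); rewrite ger0_norm ?divr_ge0// => /(_ kr).
    have pE x : (L *: (1 - 'X) ^+ m).[x] = L * (1 - x) ^+ m.
      by rewrite hornerZ horner_exp !hornerE.
    rewrite !pE subr0 expr1n mulr1 ltr_distl => /andP[/ltW + _].
    move=> /le_trans; apply.
    rewrite ler_pdivlMr ?exprn_gt0// -mulrA -exprMn mulrBl mul1r divfK ?gt_eqF//.
    by rewrite mulrAC ler_pdivrMr// [leRHS]mulrC; have [] := bounds k mk.
  have := hk0 k; rewrite ltnS leq_max leq_maxl => /(_ isT) hk.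
  rewrite (splitr e) EFinD addeA; apply: le_trans (leeD2r _ hk).
  by rewrite -EFinD lee_fin; lra.
have [c hc] := outer_le_count d0 frame.
apply/lee_addgt0Pr => e e0.
have [r r0 hr] := horner_near0 (L *: (1 + 'X) ^+ m) e0.
pose a := (d * c + m)%N; pose k := (maxn m (Num.truncn (a%:R / r))).+1.
have kR : 0 < k%:R :> R by rewrite ltr0n.
have kr : a%:R / k%:R < r.
  rewrite ltr_pdivrMr// mulrC -ltr_pdivrMr//; apply: lt_le_trans (truncnS_gt _) _.
  by rewrite ler_nat ltnS leq_maxr.
apply: le_trans (hc k isT) _; rewrite -EFinD lee_fin.
have := hr (a%:R / k%:R); rewrite ger0_norm ?divr_ge0// => /(_ kr).
have pE x : (L *: (1 + 'X) ^+ m).[x] = L * (1 + x) ^+ m.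
  by rewrite hornerZ horner_exp !hornerE.
rewrite !pE addr0 expr1n mulr1 ltr_distl => /andP[_ /ltW].
apply: le_trans.
rewrite ler_pdivrMr ?exprn_gt0// -mulrA -exprMn mulrDl mul1r divfK ?gt_eqF//.
have mk : (m <= k + d * c)%N by rewrite (leq_trans _ (leq_addr _ _))// leqW// leq_max leqnn.
have [_] := bounds _ mk.
rewrite mulrAC ler_pdivlMr// mulrC /a !natrD addrA; exact: id.
Qed.

Theorem corollary6p5 (R : realType) (d : nat) (hd : (1 <= d)%N) :
  let N := ((d - 1) ^ 2)%N in
  let n := (N %/ 2)%N in
  normalized_volume N (birkhoff R d)
    (((N`!)%:R * d%:R ^+ N)^-1 *
     \sum_(0 <= m < n.+1)
       (-1) ^+ (n + m) *
       (('C(N, n - m))%:R + (-1) ^+ d * ('C(N, n + m + 1))%:R) *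
       (nb_magic_squares d (m * d))%:R)%:E.
Proof.
move=> N n; have [t tN ht] := ehrhart_seq_exists hd.
(* N is the square of d - 1 and has its parity; this is the source of the sign (-1)^d in the
   formula. *)
have odd_N : odd N = ~~ odd d by rewrite /N oddX oddB//= addbT.
rewrite (count_alternating_sum R tN (fun k => proj1 (ht k)) (fun k => proj2 (ht k)))//.
have -> : (N`!%:R * d%:R ^+ N)^-1 * ((size t)%:R * d%:R ^+ N) = (size t)%:R / N`!%:R :> R.
  have dn0 : d%:R ^+ N != 0 :> R by rewrite expf_neq0// pnatr_eq0 -lt0n.
  by rewrite invfM mulrACA mulVf// mulr1 mulrC.
split=> [|p0 b frame]; last exact: birkhoff_volume.
case: d hd @N n t tN ht odd_N => // n' _ N n t tN ht odd_N.
rewrite /N; have -> : ((n'.+1 - 1) ^ 2 = n' * n')%N by rewrite subn1 -mulnn.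
by exists 1%:M, (@std_basis R n'); apply: std_frame.
Qed.
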